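(* Let $G$ be an infinite connected simple graph with bounded degrees that is a finite modification of $\mathbb{Z}^2$, and let $o$ be a vertex of $G$. Then for the simple random walk on $G$, $$\lim_{n\to\infty}\frac{\log n}{n}E^o[R_n]=\pi.$$
   Context: $\mathbb{Z}^2$ denotes the square integer lattice with nearest-neighbour edges. A graph $G'$ is a finite modification of a graph $G$ if there exist finite subsets $D\subset V(G)$ and $D'\subset V(G')$ such that there is a graph isomorphism $\phi:V(G)\setminus D\to V(G')\setminus D'$, where $V(G)\setminus D$ and $V(G')\setminus D'$ carry the induced subgraph structures of $G$ and $G'$ respectively. The simple random walk $(S_n)_{n\ge0}$ under $P^o$ starts at $o$ and at each step moves from its current vertex $z$ to each neighbour of $z$ with probability $1/\deg(z)$; $E^o$ is the expectation under $P^o$, and $R_n=|\{S_0,\dots,S_n\}|$ is the range. *)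

(* Defs.v *)
From HB Require Import structures.
From mathcomp Require Import all_boot all_order all_algebra finmap.
From mathcomp Require Import all_classical all_reals all_analysis.

Set Implicit Arguments.
Unset Strict Implicit.
Unset Printing Implicit Defensive.

Import Order.TTheory GRing.Theory Num.Theory.
Import numFieldNormedType.Exports.

Local Open Scope classical_set_scope.
Local Open Scope ring_scope.

Record sgraph := SGraph {
  vertex :> choiceType;
  adj : rel vertex;
  adj_sym : symmetric adj;
  adj_irrefl : irreflexive adj }.

Definition neighbours (G : sgraph) (x : G) : set G := [set y | adj x y].

(* [fset_set] is empty on infinite sets, so this is only meaningful at
   vertices with finitely many neighbours. *)
Definition degree (G : sgraph) (x : G) : nat := #|` fset_set (neighbours x)|.

Definition bounded_degrees (G : sgraph) : Prop :=
  exists M : nat, forall x : G,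
    finite_set (neighbours x) /\ (degree x <= M)%N.

Definition connected_graph (G : sgraph) : Prop :=
  forall x y : G, exists2 p : seq G, path (@adj G) x p & last x p = y.

Definition graph_iso (G H : sgraph) : Prop :=
  exists2 f : G -> H, bijective f & forall x y : G, adj (f x) (f y) = adj x y.

Section Induced.
Variables (G : sgraph) (D : {fset G}).

Let induced_adj : rel {x : G | x \notin D} := fun x y => adj (val x) (val y).

Let induced_adj_sym : symmetric induced_adj.
Proof. by move=> x y; exact: adj_sym. Qed.

Let induced_adj_irrefl : irreflexive induced_adj.
Proof. by move=> x; exact: adj_irrefl. Qed.

Definition remove_vertices : sgraph :=
  SGraph induced_adj_sym induced_adj_irrefl.

End Induced.

Definition finite_modification (G G' : sgraph) : Prop :=
  exists (D : {fset G}) (D' : {fset G'}),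
    graph_iso (remove_vertices D) (remove_vertices D').

Definition Z2_adj : rel (int * int) :=
  fun x y => (absz (x.1 - y.1) + absz (x.2 - y.2) == 1)%N.

Lemma Z2_adj_sym : symmetric Z2_adj.
Proof. by move=> x y; rewrite /Z2_adj distnC [X in (_ + X)%N]distnC. Qed.

Lemma Z2_adj_irrefl : irreflexive Z2_adj.
Proof. by move=> x; rewrite /Z2_adj !distnn. Qed.

Definition Z2 : sgraph := SGraph Z2_adj_sym Z2_adj_irrefl.

Definition srw_trans (R : realType) (G : sgraph) (x y : G) : R :=
  if adj x y then (degree x)%:R^-1 else 0.

(* [S] is a simple random walk on [G] started at [o], realized on the
   probability space [(T, P)].  [G] carries the discrete sigma-algebra.  The
   Markov property is written multiplicatively, so that no conditioning on
   null events occurs: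
   P(S_0 = x_0, ..., S_{n+1} = x_{n+1})
     = P(S_0 = x_0, ..., S_n = x_n) * p(x_n, x_{n+1}). *)
Record simple_random_walk (R : realType) (G : sgraph) (o : G)
    (d : measure_display) (T : measurableType d) (P : probability T R)
    (S : nat -> T -> G) : Prop := SimpleRandomWalk {
  srw_measurable : forall (n : nat) (A : set G), measurable (S n @^-1` A);
  srw_start : P (S 0%N @^-1` [set o]) = 1%E;
  srw_step : forall (n : nat) (x : nat -> G),
    P [set w | forall i, (i <= n.+1)%N -> S i w = x i] =
    (P [set w | forall i, (i <= n)%N -> S i w = x i] *
     (srw_trans R (x n) (x n.+1))%:E)%E }.

Definition range_size (G : sgraph) (T : Type) (S : nat -> T -> G)
    (n : nat) (w : T) : nat :=
  #|` fset_set [set S i w | i in [set i | (i <= n)%N]]|.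

(* Main.v *)
Require Import Defs.
From HB Require Import structures.
From mathcomp Require Import all_boot all_order all_algebra finmap.
From mathcomp Require Import all_classical all_reals all_analysis.
From mathcomp Require Import measurable_realfun zify ring lra.

Set Implicit Arguments.
Unset Strict Implicit.
Unset Printing Implicit Defensive.

Import Order.TTheory GRing.Theory Num.Theory.
Import numFieldNormedType.Exports.

Local Open Scope classical_set_scope.
Local Open Scope ring_scope.

(** The mean range is the sum over [k <= n] of the probability that the vertex
    occupied at time [k] is not visited again up to time [n]
    ([expectation_range]). From a vertex [x], the probability of no return
    within [n] steps is governed by the mean number of visits to [x]:
    decomposing at the last visit, the sum over [j <= n] of [p_j(x,x)] times the
    probability of no return within [n - j] steps is [1]. On the square lattice
    [p_{2i}(0,0)] is the square of [binomial(2i, i) / 4 ^ i], which Wallis'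
    formula estimates by [1 / (pi i)], so that the mean number of returns up to
    time [n] is [ln n / pi + O(1)] ([lattice_green_ge], [lattice_green_le]) and
    the probability of no return is equivalent to [pi / ln n].

    A finite modification [G] coincides with the lattice off a finite set [C]
    ([chart_exists]), so it is enough that the walk spends most of its time at
    vertices from which it hardly feels [C]. Let [N] be [n] divided by about
    [(ln n) ^ 4]. A vertex off [C] is good when the lattice walk started from
    its image makes on average at most one visit to the image of [C] up to time
    [N]. From a good vertex the expected number of such visits up to time [4 n]
    is only [O(ln ln n)], because [p_j <= 2 / (j + 1)], whereas each walk which
    hits [C] spends there on average a time of order [ln n]; hence [C] is hit
    within [2 n] steps with probability [O(ln ln n / ln n)] ([lattice_hit_le]).
    The walks killed on [C] are the same in [G] and in the lattice, and this
    gives the equivalent [pi / ln n] for the probability of no return in [G]: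
    for the upper bound ([no_return_good_le]) the mean number of returns of the
    killed walk is enough, and for the lower bound ([no_return_good_ge]) one
    uses that a walk which makes about [ln n] excursions from [x] before leaving
    for good would hit [C] too often if a single excursion did so with a
    probability comparable with [1 / ln n] ([avoid_killed_ge]).

    It remains to bound the time spent at bad vertices ([green_bad_le]). From
    some vertex of [C] the walk avoids [C] for a time [n] with probability at
    least of order [1 / ln n], by the same last visit decomposition for the set
    [C]; as [G] is connected, the expected time spent in [C] is [O(ln n)]
    ([green_core_le]). During one excursion off [C] the walk is dominated by the
    lattice walk, which spends a time [O(N ln n)] at bad vertices. The total
    [O(N (ln n) ^ 2)] is negligible with respect to [n / ln n]. *)

(** * Sub-Markov operators *)

Section SubMarkov.
Variables (R : realType) (V : eqType).
Implicit Types (P : (V -> R) -> V -> R) (A : pred V) (f g : V -> R).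

(** A positive linear operator on functions that maps [1] to a function at most
    [1].  Transition kernels are handled through their action on functions, so
    that killing a walk on a set gives an operator of the same kind. *)
Record sub_markov P : Prop := SubMarkov {
  sub_markov_lin : forall a f g,
    P (fun x => a * f x + g x) = (fun x => a * P f x + P g x);
  sub_markov_ge0 : forall f, (forall x, 0 <= f x) -> forall x, 0 <= P f x;
  sub_markov_le1 : forall x, P (fun=> 1) x <= 1 }.

(** The indicator of [A], and the restriction of [f] to [A]. *)
Definition ind A : V -> R := fun x => (A x)%:R.
Definition restr A f : V -> R := fun x => (A x)%:R * f x.

(** [killed A P] is the operator of the walk killed when it enters [A]. *)
Definition killed A P : (V -> R) -> V -> R := fun f => P (restr (predC A) f).

(** [green P n f x] is the expectation of [f(S_0) + ... + f(S_n)] from [x]. *)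
Definition green P n f x : R := \sum_(j < n.+1) iter j P f x.

(** [avoid P A n x] is the probability from [x] that none of [S_1], ..., [S_n]
    lies in [A]; [hit P A n x] is the probability of the complement. *)
Definition avoid P A n : V -> R := iter n (killed A P) (fun=> 1).
Definition hit P A n x : R := 1 - avoid P A n x.

Section Basics.
Variables (P : (V -> R) -> V -> R) (hP : sub_markov P).

Lemma sm0 : P (fun=> 0) = fun=> 0.
Proof.
have := sub_markov_lin hP (-1) (fun=> 0) (fun=> 0).
under eq_fun do rewrite mulr0 addr0.
by move=> ->; apply/funext => x; rewrite mulN1r addNr.
Qed.

Lemma smD f g : P (fun x => f x + g x) = fun x => P f x + P g x.
Proof.
have := sub_markov_lin hP 1 f g.
under eq_fun do rewrite mul1r.
by move=> ->; apply/funext => x; rewrite mul1r.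
Qed.

Lemma smZ a f : P (fun x => a * f x) = fun x => a * P f x.
Proof.
have := sub_markov_lin hP a f (fun=> 0).
under eq_fun do rewrite addr0.
by move=> ->; apply/funext => x; rewrite sm0 addr0.
Qed.

Lemma sm_sum (I : Type) (r : seq I) (F : I -> V -> R) :
  P (fun x => \sum_(i <- r) F i x) = fun x => \sum_(i <- r) P (F i) x.
Proof.
elim: r => [|i r IH].
  under eq_fun do rewrite big_nil.
  by rewrite sm0; apply/funext => x; rewrite big_nil.
under eq_fun do rewrite big_cons.
by rewrite smD IH; apply/funext => x; rewrite big_cons.
Qed.

Lemma sm_mono f g : (forall x, f x <= g x) -> forall x, P f x <= P g x.
Proof.
move=> fg x; have -> : g = fun y => f y + (g y - f y).
  by apply/funext => y; rewrite addrC subrK.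
rewrite smD lerDl; apply: (sub_markov_ge0 hP) => y.
by rewrite subr_ge0.
Qed.

Lemma sm_le_cst f a : 0 <= a -> (forall x, f x <= a) -> forall x, P f x <= a.
Proof.
move=> a0 fa x; apply: (@le_trans _ _ (P (fun=> a * 1) x)).
  by apply: sm_mono => y; rewrite mulr1.
by rewrite smZ ler_piMr// sub_markov_le1.
Qed.

Lemma sub_markov_iter n : sub_markov (iter n P).
Proof.
elim: n => [|n IH]; first by split.
split=> [a f g|f f0 x|x] /=.
- by rewrite (sub_markov_lin IH) (sub_markov_lin hP).
- by apply: (sub_markov_ge0 hP) => y; exact: (sub_markov_ge0 IH).
- by apply: sm_le_cst => // y; exact: (sub_markov_le1 IH).
Qed.

Lemma sub_markov_killed A : sub_markov (killed A P).
Proof.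
split=> [a f g|f f0 x|x].
- rewrite /killed -(sub_markov_lin hP); congr (P _).
  by apply/funext => x; rewrite /restr; ring.
- by apply: (sub_markov_ge0 hP) => y; rewrite mulr_ge0.
- by apply: sm_le_cst => // y; rewrite /restr mulr1 /= -[1]/(1%:R) ler_nat leq_b1.
Qed.

Lemma sm_split A f x : P f x = killed A P f x + P (restr A f) x.
Proof.
rewrite /killed -[RHS]/((fun x => P _ x + P _ x) x) -smD; congr (P _ _).
by apply/funext => y; rewrite /restr /=; case: (A y); rewrite ?(mul1r, mul0r, add0r, addr0).
Qed.

Lemma green0 f x : green P 0 f x = f x.
Proof. by rewrite /green big_ord1. Qed.

Lemma greenSr n f x : green P n.+1 f x = green P n f x + iter n.+1 P f x.
Proof. by rewrite /green big_ord_recr. Qed.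

Lemma greenS n f x : green P n.+1 f x = f x + P (green P n f) x.
Proof.
rewrite /green big_ord_recl /=; congr (_ + _).
have := sm_sum (index_enum 'I_n.+1) (fun i => iter i P f).
by move=> /(congr1 (fun h => h x)) ->.
Qed.

Lemma green_ge0 n f : (forall x, 0 <= f x) -> forall x, 0 <= green P n f x.
Proof.
by move=> f0 x; apply: sumr_ge0 => i _; exact: (sub_markov_ge0 (sub_markov_iter _)).
Qed.


End Basics.

Section Iter.
Variables (P : (V -> R) -> V -> R) (hP : sub_markov P).

Lemma iter_mono n f g : (forall x, f x <= g x) ->
  forall x, iter n P f x <= iter n P g x.
Proof. exact: (sm_mono (sub_markov_iter hP n)). Qed.

Lemma iter_ge0 n f : (forall x, 0 <= f x) -> forall x, 0 <= iter n P f x.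
Proof. exact: (sub_markov_ge0 (sub_markov_iter hP n)). Qed.

Lemma green_mono n f g : (forall x, f x <= g x) ->
  forall x, green P n f x <= green P n g x.
Proof. by move=> fg x; apply: ler_sum => i _; exact: iter_mono. Qed.

Lemma greenZ n a f x : green P n (fun y => a * f y) x = a * green P n f x.
Proof.
rewrite /green mulr_sumr; apply: eq_bigr => i _.
by rewrite (smZ (sub_markov_iter hP i)).
Qed.

Lemma greenD n f g x :
  green P n (fun y => f y + g y) x = green P n f x + green P n g x.
Proof.
rewrite /green -big_split; apply: eq_bigr => i _.
by rewrite (smD (sub_markov_iter hP i)).
Qed.

Lemma green_sum n (I : Type) (r : seq I) (F : I -> V -> R) x :
  green P n (fun y => \sum_(i <- r) F i y) x = \sum_(i <- r) green P n (F i) x.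
Proof.
rewrite /green exchange_big; apply: eq_bigr => i _.
by rewrite (sm_sum (sub_markov_iter hP i)).
Qed.

Lemma green_leS m n f : (m <= n)%N -> (forall x, 0 <= f x) ->
  forall x, green P m f x <= green P n f x.
Proof.
move=> mn f0 x; rewrite -(subnK mn); elim: (n - m)%N => // k IH.
by rewrite addSn greenSr (le_trans IH)// lerDl iter_ge0.
Qed.

Lemma ind_ge0 A x : 0 <= ind A x. Proof. exact: ler0n. Qed.

Lemma avoid_ge0 A n x : 0 <= avoid P A n x.
Proof. by apply: (sub_markov_ge0 (sub_markov_iter (sub_markov_killed hP A) n)). Qed.

Lemma avoid_le1 A n x : avoid P A n x <= 1.
Proof. exact: (sub_markov_le1 (sub_markov_iter (sub_markov_killed hP A) n)). Qed.

Lemma avoid_anti A m n x : (m <= n)%N -> avoid P A n x <= avoid P A m x.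
Proof.
move=> mn; rewrite -(subnKC mn) /avoid iterD.
apply: (sm_mono (sub_markov_iter (sub_markov_killed hP A) m)) => y.
exact: avoid_le1.
Qed.

Lemma hit_ge0 A n x : 0 <= hit P A n x.
Proof. by rewrite subr_ge0 avoid_le1. Qed.

Lemma restr_ind A x : restr A (fun=> 1) x = ind A x.
Proof. by rewrite /restr mulr1. Qed.

(** Decomposition at the last visit to [A]. *)
Lemma last_exit A m f x : iter m P f x = iter m (killed A P) f x +
  \sum_(i < m) iter i.+1 P (restr A (iter (m.-1 - i) (killed A P) f)) x.
Proof.
elim: m f => [|m IH] f; first by rewrite big_ord0 addr0.
rewrite iterSr.
have -> : P f = fun y => killed A P f y + P (restr A f) y.
  by apply/funext => y; exact: sm_split.
rewrite (smD (sub_markov_iter hP m)) IH big_ord_recr /= subnn -addrA.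
congr (_ + (_ + _)); first by rewrite -iterSr.
  apply: eq_bigr => i _; rewrite -iterSr.
  by have -> : ((m.-1 - i).+1 = m - i)%N by case: i => i /= ?; lia.
by rewrite -iterSr.
Qed.

Hypothesis P1 : P (fun=> 1) = fun=> 1.

Lemma iter1 n : iter n P (fun=> 1) = fun=> 1.
Proof. by elim: n => //= n ->. Qed.

Lemma last_exit1 A m x : 1 = avoid P A m x +
  \sum_(i < m) iter i.+1 P (restr A (avoid P A (m.-1 - i))) x.
Proof. by rewrite -last_exit iter1. Qed.

(** At most one of the visits to [A] before time [n] is followed by an
    excursion of length [n] away from [A]. *)
Lemma green_avoid_le1 A n x : green P n (restr A (avoid P A n)) x <= 1.
Proof.
rewrite [leRHS](last_exit1 A n x) /green big_ord_recl /=; apply: lerD.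
  by rewrite /restr ler_piMl ?avoid_ge0// -[1]/(1%:R) ler_nat leq_b1.
apply: ler_sum => i _; apply: (@iter_mono i.+1) => y.
by rewrite ler_wpM2l// avoid_anti//; lia.
Qed.

(** Conversely, up to time [M + n] there is a last visit to [A]; if it occurs
    before time [M], it is followed by an excursion of length [n]. *)
Lemma green_avoid_ge1 A M n x : A x ->
  1 <= green P M (restr A (avoid P A n)) x +
       \sum_(i < n) iter (M + i).+1 P (ind A) x.
Proof.
move=> Ax; rewrite [leLHS](last_exit1 A (M + n) x) big_split_ord /= addrA.
apply: lerD; last first.
  apply: ler_sum => i _; apply: (@iter_mono (M + i).+1) => y.
  by rewrite -restr_ind ler_wpM2l// avoid_le1.
rewrite /green big_ord_recl /=; apply: lerD.
  by rewrite /restr Ax mul1r avoid_anti// leq_addl.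
apply: ler_sum => i _; apply: (@iter_mono i.+1) => y.
by rewrite ler_wpM2l// avoid_anti//; case: i => i /= ?; lia.
Qed.

Lemma hit0 A x : hit P A 0 x = 0. Proof. by rewrite /hit subrr. Qed.

Lemma hitS A m x : hit P A m.+1 x = P (ind A) x + killed A P (hit P A m) x.
Proof.
have -> : hit P A m = fun y => 1 + (-1) * avoid P A m y.
  by apply/funext => y; rewrite /hit mulN1r.
have hC := sub_markov_killed hP A.
rewrite (smD hC) (smZ hC) mulN1r addrA /hit; congr (_ - _).
rewrite addrC -[LHS]/((fun=> 1) x) -{1}P1 (sm_split hP A).
by congr (_ + P _ _); apply/funext => y; rewrite restr_ind.
Qed.

(** If a walk started in [A] spends at least the time [a] in [A] up to time [K],
    then hitting [A] within [m] steps costs a time [a] in [A] up to [m + K]. *)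
Lemma hit_green A K m a x : (forall y, A y -> a <= green P K (ind A) y) ->
  hit P A m x * a <= green P (m + K) (ind A) x.
Proof.
move=> aA; elim: m x => [|m IH] x.
  by rewrite hit0 mul0r green_ge0 // => y; exact: ind_ge0.
rewrite hitS addSn greenS//; apply: ler_wpDl; first exact: ind_ge0.
rewrite [leRHS](sm_split hP A) [leRHS]addrC mulrDl; apply: lerD.
  rewrite mulrC -[leLHS]/((fun x => a * _ x) x) -(smZ hP).
  apply: (sm_mono hP) => y; rewrite /restr /ind mulrC.
  have [Ay|] := boolP (A y); rewrite ?mul0r// !mul1r.
  by apply: (le_trans (aA _ Ay)); apply: green_leS; [rewrite leq_addl|exact: ind_ge0].
rewrite mulrC -[leLHS]/((fun x => a * _ x) x) -(smZ (sub_markov_killed hP A)).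
by apply: (sm_mono (sub_markov_killed hP A)) => y; rewrite mulrC.
Qed.

(** Killing on [A] loses at most what is collected after hitting [A]. *)
Lemma green_killed_ge A n f M x : (forall y, 0 <= f y) ->
  (forall y, A y -> green P n f y <= M) ->
  green P n f x <= green (killed A P) n f x + hit P A n x * M.
Proof.
move=> f0 fM; suff H k y : (k <= n)%N ->
  green P k f y <= green (killed A P) k f y + hit P A k y * M by exact: H.
elim: k y => [|k IH] {}x kn.
  by rewrite !green0 hit0 mul0r addr0.
have hC := sub_markov_killed hP A.
rewrite (greenS hP) (greenS hC) hitS -addrA lerD2l.
rewrite [leLHS](sm_split hP A) mulrDl [leLHS]addrC [leRHS]addrCA.
apply: lerD.
  rewrite mulrC -[leRHS]/((fun x => M * _ x) x) -(smZ hP).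
  apply: (sm_mono hP) => y; rewrite /restr /ind mulrC.
  have [Ay|] := boolP (A y); rewrite ?mulr0// !mulr1.
  by apply: le_trans (fM _ Ay); apply: green_leS => //; exact: ltnW.
rewrite [killed A P (hit _ _ _) _ * _]mulrC.
rewrite -[X in _ + X]/((fun x => M * _ x) x) -(smZ hC).
rewrite -[leRHS]/((fun x => killed A P _ x + _ x) x) -(smD hC).
by apply: (sm_mono hC) => y; rewrite [M * _]mulrC; apply: IH; exact: ltnW.
Qed.

End Iter.

Section Escape.
Variables (P : (V -> R) -> V -> R) (hP : sub_markov P).
Hypothesis P1 : P (fun=> 1) = fun=> 1.
Variables (A : pred V) (x : V).

(** The walk killed on [A] and on its return to [x]. *)
Let Q := killed (pred1 x) (killed A P).

Let hA := sub_markov_killed hP A.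
Let hQ : sub_markov Q := sub_markov_killed hA (pred1 x).

(** The probability of hitting [A] within [n] steps and before [x]. *)
Let hit_first n : V -> R := iter n (fun w y => P (ind A) y + Q w y) (fun=> 0).

Let hit_first_ge0 n y : 0 <= hit_first n y.
Proof.
elim: n y => //= n IH y; rewrite addr_ge0 //.
  by apply: (sub_markov_ge0 hP) => z; exact: ind_ge0.
exact: (sub_markov_ge0 hQ).
Qed.

Let hit_first_mono n y : hit_first n y <= hit_first n.+1 y.
Proof.
elim: n y => [|n IH] y; first exact: hit_first_ge0.
by rewrite /= lerD2l; exact: (sm_mono hQ).
Qed.

Let hit_first_le_hit n y : hit_first n y <= hit P A n y.
Proof.
elim: n y => [|n IH] y; first by rewrite hit0.
rewrite hitS//= lerD2l; apply: (@le_trans _ _ (Q (hit P A n) y)).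
  exact: (sm_mono hQ).
rewrite /Q /killed; apply: (sm_mono hP) => z; rewrite ler_wpM2l// ler_piMl ?hit_ge0//.
by rewrite -[1]/(1%:R) ler_nat leq_b1.
Qed.

(** The left-hand side adds the probabilities of two disjoint ways of hitting
    [A]: within [n] steps and before visiting [x], or after a last visit to [x]
    between the times [1] and [k] and within [n] steps of it. *)
Let hit_ge_first n k y :
  hit_first n y +
    hit_first n x * (green (killed A P) k (ind (pred1 x)) y - ind (pred1 x) y)
  <= hit P A (n + k) y.
Proof.
elim: k y => [|k IH] y.
  by rewrite green0 subrr mulr0 addr0 addn0.
rewrite addnS hitS// (greenS hA) [X in _ * X]addrAC subrr add0r.
have := sm_mono hA IH y.
set W := hit_first n x.
have -> : (fun z => hit_first n z +
    W * (green (killed A P) k (ind (pred1 x)) z - ind (pred1 x) z)) =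
  (fun z => (W * green (killed A P) k (ind (pred1 x)) z) +
     restr (predC (pred1 x)) (hit_first n) z).
  apply/funext => z; rewrite /restr /ind /=.
  by have [->|zx] := eqVneq z x; rewrite /= /W; ring.
rewrite (smD hA) (smZ hA) -/(Q (hit_first n)) => h.
rewrite -(lerD2l (P (ind A) y)) in h.
apply: le_trans h; rewrite [leLHS]addrC addrCA lerD2l.
by rewrite -/(hit_first n.+1 y); have := hit_first_mono n y; rewrite /= .
Qed.

(** The probabilities of avoiding [x], and of avoiding both [x] and [A], differ
    by at most the probability that an excursion from [x] hits [A]; as the walk
    makes [green (killed A P) n (ind (pred1 x)) x] visits to [x] on average
    before hitting [A], this is small when [A] is unlikely to be hit. *)
Lemma avoid_killed_ge n : ~~ A x ->
  (avoid P (pred1 x) n x - iter n Q (fun=> 1) x) *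
    green (killed A P) n (ind (pred1 x)) x <= hit P A (n + n) x.
Proof.
move=> Ax.
(* The walk that avoids [x] but not [A] hits [A] first. *)
have le_w k y : avoid P (pred1 x) k y - iter k Q (fun=> 1) y <= hit_first k y.
  elim: k y => [|k IH] y; first by rewrite subrr.
  rewrite /= -!/(avoid _ _ _).
  have -> : killed (pred1 x) P (avoid P (pred1 x) k) y =
    P (fun z => restr (predC (pred1 x)) (restr A (avoid P (pred1 x) k)) z +
     restr (predC A) (restr (predC (pred1 x)) (avoid P (pred1 x) k)) z) y.
    congr (P _ _); apply/funext => z; rewrite /restr /=.
    by case: (A z); rewrite /=; ring.
  rewrite (smD hP) -addrA; apply: lerD.
    apply: (sm_mono hP) => z; rewrite -restr_ind /restr mulrCA ler_wpM2l//.
    by rewrite mulr_ile1 ?avoid_ge0 ?avoid_le1// -[1]/(1%:R) ler_nat leq_b1.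
  have := sm_mono hQ IH y.
  have -> : (fun x0 : V => avoid P (pred1 x) k x0 - iter k Q (fun=> 1) x0) =
    (fun z => -1 * iter k Q (fun=> 1) z + avoid P (pred1 x) k z).
    by apply/funext => z; rewrite mulN1r addrC.
  by rewrite (sub_markov_lin hQ) mulN1r addrC.
have := hit_ge_first n n x.
rewrite {2}/ind /= eqxx mulrBr mulr1 addrC subrK.
apply: le_trans; rewrite ler_wpM2r// green_ge0// => y; exact: ind_ge0.
Qed.

End Escape.

End SubMarkov.

Section MoreSubMarkov.
Variables (R : realType) (V : eqType) (P : (V -> R) -> V -> R).
Hypothesis hP : sub_markov P.

Lemma killed_killed (A B : pred V) : killed A (killed B P) = killed (predU A B) P.
Proof.
apply/funext => f; rewrite /killed; congr (P _); apply/funext => x.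
by rewrite /restr /= negb_or -mulnb natrM; ring.
Qed.

Lemma killed_iter_le (A B : pred V) n f : (forall x, 0 <= f x) -> subpred A B ->
  forall x, iter n (killed B P) f x <= iter n (killed A P) f x.
Proof.
move=> f0 AB; elim: n => //= n IH x; rewrite /killed; apply: (sm_mono hP) => y.
rewrite /restr /=; have [Ay|Ay] := boolP (A y); first by rewrite (AB _ Ay) /= !mul0r.
rewrite /= mul1r; case: (B y); rewrite ?mul0r ?mul1r; last exact: IH.
exact: (sub_markov_ge0 (sub_markov_iter (sub_markov_killed hP A) n)).
Qed.

Lemma iter_killed_le (A : pred V) n f : (forall x, 0 <= f x) ->
  forall x, iter n (killed A P) f x <= iter n P f x.
Proof.
move=> f0; elim: n => //= n IH x; apply: (sm_mono hP) => y.
rewrite /restr /=; case: (A y); rewrite ?mul0r ?mul1r; last exact: IH.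
exact: (sub_markov_ge0 (sub_markov_iter hP n)).
Qed.

(** The time collected after a visit to [C] and before the next one is at most
    [M], whence a bound in terms of the number of visits to [C] after time [0]. *)
Lemma green_le_killed (C : pred V) n f M x : 0 <= M -> (forall y, 0 <= f y) ->
  (forall y, C y -> green (killed C P) n f y <= M) ->
  green P n f x <= green (killed C P) n f x + M * (green P n (ind R C) x - ind R C x).
Proof.
move=> M0 f0 fM; suff H k y : (k <= n)%N -> green P k f y <=
    green (killed C P) k f y + M * (green P k (ind R C) y - ind R C y) by exact: H.
have hC := sub_markov_killed hP C.
elim: k y => [|k IH] {}x kn; first by rewrite !green0 subrr mulr0 addr0.
rewrite !greenS// [X in M * X]addrC addKr -addrA lerD2l.
apply: (@le_trans _ _ (P (fun y => green (killed C P) k f y +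
    M * (green P k (ind R C) y - ind R C y)) x)).
  by apply: (sm_mono hP) => y; apply: IH; exact: ltnW.
rewrite (smD hP) (smZ hP) (sm_split hP C) -addrA lerD2l.
have -> : P (fun y => green P k (ind R C) y - ind R C y) x =
    P (green P k (ind R C)) x - P (ind R C) x.
  rewrite -[RHS]addrC -mulN1r.
  rewrite -[RHS]/((fun y => -1 * P (ind R C) y + P (green P k (ind R C)) y) x).
  rewrite -(sub_markov_lin hP); congr (P _ _); apply/funext => y.
  by rewrite mulN1r addrC.
suff : P (restr C (green (killed C P) k f)) x <= M * P (ind R C) x by lra.
rewrite -[leRHS]/((fun y => M * P (ind R C) y) x) -(smZ hP).
apply: (sm_mono hP) => y; rewrite /restr /ind.
have [Cy|_] := boolP (C y); rewrite ?mul0r ?mulr0// mul1r mulr1.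
by apply: le_trans (fM _ Cy); apply: green_leS => //; exact: ltnW.
Qed.

Lemma avoid_pred1 x n y :
  restr (pred1 x) (avoid P (pred1 x) n) y = avoid P (pred1 x) n x * ind R (pred1 x) y.
Proof.
rewrite /restr /ind /=; case: eqVneq => [->|].
  by rewrite mul1r mulr1.
by rewrite mul0r mulr0.
Qed.

Hypothesis P1 : P (fun=> 1) = fun=> 1.

(** The last visit decomposition for a single point. *)
Lemma avoid_green_le1 x n :
  avoid P (pred1 x) n x * green P n (ind R (pred1 x)) x <= 1.
Proof.
rewrite -(greenZ hP); have := green_avoid_le1 hP P1 (pred1 x) n x.
by rewrite (_ : restr _ _ = fun y => avoid P (pred1 x) n x * ind R (pred1 x) y)//;
  apply/funext => y; exact: avoid_pred1.
Qed.

End MoreSubMarkov.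

(** * Central binomial coefficients *)

Section Wallis.
Variable R : realType.
Implicit Types (x : R) (n i : nat).

(** The antiderivative of [cos x ^+ n] that vanishes at [0], given by the
    reduction formula of integration by parts. *)
Fixpoint cos_pow_primitive n x : R :=
  match n with
  | 0 => x
  | 1 => sin x
  | (m.+1 as p).+1 => m.+2%:R^-1 *
      (cos x ^+ p * sin x + m.+1%:R * cos_pow_primitive m x)
  end.

Lemma is_derive_cos_pow_primitive n x :
  is_derive x 1 (cos_pow_primitive n) (cos x ^+ n).
Proof.
suff : is_derive x 1 (cos_pow_primitive n) (cos x ^+ n) /\
  is_derive x 1 (cos_pow_primitive n.+1) (cos x ^+ n.+1) by case.
elim: n => [|n [IH0 IH1]].
  by split; [exact: is_derive_id|rewrite expr1; exact: is_derive_sin].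
split=> //.
have -> : cos_pow_primitive n.+2 = (n.+2%:R^-1 : R) \*:
    ((cos ^+ n.+1 * sin) + (n.+1%:R : R) \*: cos_pow_primitive n)%R.
  by apply/funext => y /=; rewrite !fctE.
apply: is_derive_eq.
rewrite /GRing.scale /= !fctE.
have n2 : n.+2%:R != 0 :> R by rewrite pnatr_eq0.
apply: (mulfI n2); rewrite mulVKf//.
have -> : n.+2%:R = n.+1%:R + 1 :> R by rewrite -natr1.
transitivity (cos x ^+ n.+2 + n.+1%:R * cos x ^+ n * (1 - sin x ^+ 2)).
  by rewrite !exprS; ring.
by rewrite sin2cos2 !exprS; ring.
Qed.

(** The Wallis integral of [cos x ^+ n] over the quarter period. *)
Definition wallis n : R := cos_pow_primitive n (pi / 2).

Lemma wallis_rec n : n.+2%:R * wallis n.+2 = n.+1%:R * wallis n.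
Proof.
by rewrite /wallis /= cos_pihalf expr0n /= mul0r add0r mulVKf// pnatr_eq0.
Qed.

(** Together with monotonicity, this invariant pins down the integrals. *)
Lemma wallis_prod n : n.+1%:R * wallis n.+1 * wallis n = pi / 2.
Proof.
elim: n => [|n IH]; first by rewrite /wallis /= sin_pihalf !mul1r.
by rewrite wallis_rec -IH; ring.
Qed.

Lemma cos_pow_primitive0 n : cos_pow_primitive n 0 = 0.
Proof.
suff : cos_pow_primitive n 0 = 0 /\ cos_pow_primitive n.+1 0 = 0 by case.
elim: n => [|n [IH0 IH1]]; first by rewrite /= sin0.
by split; rewrite //= sin0 IH0 !mulr0 addr0 mulr0.
Qed.

Lemma wallis_anti n : wallis n.+1 <= wallis n.
Proof.
pose f x : R := cos_pow_primitive n x - cos_pow_primitive n.+1 x.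
have df x : is_derive x 1 f (cos x ^+ n - cos x ^+ n.+1).
  by apply: is_deriveB; exact: is_derive_cos_pow_primitive.
have pi2 : 0 <= pi / 2 :> R by rewrite divr_ge0// pi_ge0.
have : f 0 <= f (pi / 2).
  apply: (@ger0_derive1_le_cc _ f 0 (pi / 2)) => //.
  - by move=> x; rewrite in_itv /= => /andP[x0 x1]; rewrite derive1E derive_val exprSr;
      rewrite -{1}[_ ^+ n]mulr1 -mulrBr mulr_ge0 ?exprn_ge0 ?subr_ge0 ?cos_le1//;
      apply: cos_ge0_pihalf; rewrite (ltW x1) andbT; apply: le_trans (ltW x0);
      rewrite oppr_le0.
  - apply: continuous_subspaceT => x.
    by apply: differentiable_continuous; apply/derivable1_diffP; apply: ex_derive.
  - by rewrite in_itv /= lexx.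
  - by rewrite in_itv /= lexx andbT.
by rewrite /f !cos_pow_primitive0 subrr subr_ge0.
Qed.

Lemma wallis_gt0 n : 0 < wallis n.
Proof.
have h m : 0 < wallis m -> 0 < wallis m.+1.
  move=> m0; have : 0 < pi / 2 :> R by rewrite divr_gt0// pi_gt0.
  by rewrite -(wallis_prod m) pmulr_lgt0// pmulr_rgt0.
elim: n => [|n]; last exact: h.
by rewrite /wallis /= divr_gt0// pi_gt0.
Qed.

(** The probability that a simple random walk on the integers is back at its
    starting point after [2 * i] steps. *)
Definition cbin i : R := 'C(i.*2, i)%:R / 2 ^+ i.*2.

Lemma cbinS i : i.*2.+2%:R * cbin i.+1 = i.*2.+1%:R * cbin i.
Proof.
rewrite /cbin doubleS.
have : (i.+1 * (i.+1 * 'C(i.*2.+2, i.+1)) = i.*2.+2 * (i.*2.+1 * 'C(i.*2, i)))%N.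
  have h1 := mul_bin_diag i.*2.+2 i; have h2 := mul_bin_down i.*2.+1 i.
  rewrite /= in h1 h2; rewrite -h1 mulnCA h2; congr (_ * (_ * _))%N.
  by rewrite -addnn; lia.
move=> /(congr1 (fun n => n%:R : R)); rewrite !natrM !exprS => h.
have i1 : i.+1%:R != 0 :> R by rewrite pnatr_eq0.
have e : i.*2.+2%:R = 2 * i.+1%:R :> R by rewrite -natrM; congr _%:R; lia.
rewrite e in h *.
have {}h : i.+1%:R * 'C(i.*2.+2, i.+1)%:R = 2 * (i.*2.+1%:R * 'C(i.*2, i)%:R) :> R.
  by apply: (mulfI i1); rewrite h; ring.
rewrite !invfM; transitivity (i.+1%:R * 'C(i.*2.+2, i.+1)%:R * 2^-1 / 2 ^+ i.*2 : R).
  by field; rewrite expf_neq0.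
by rewrite h; field; rewrite expf_neq0.
Qed.

Lemma cbin_gt0 i : 0 < cbin i.
Proof. by rewrite divr_gt0 ?exprn_gt0// ltr0n bin_gt0; lia. Qed.

Lemma cbin_wallis i : wallis i.*2 = cbin i * (pi / 2).
Proof.
elim: i => [|i IH].
  by rewrite /cbin double0 bin0 expr0 divr1 mul1r.
have i2 : i.*2.+2%:R != 0 :> R by rewrite pnatr_eq0.
apply: (mulfI i2); rewrite [RHS]mulrA cbinS doubleS wallis_rec IH.
by rewrite mulrA.
Qed.

Lemma cbin_sqr_ge i : i.+1%:R^-1 <= pi * cbin i ^+ 2.
Proof.
have w : pi / 2 <= i.*2.+1%:R * (cbin i * (pi / 2)) ^+ 2 :> R.
  rewrite -cbin_wallis -(wallis_prod i.*2) expr2 -mulrA ler_wpM2l//.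
  by rewrite ler_wpM2r ?wallis_anti ?ltW ?wallis_gt0.
have pi0 : 0 < pi :> R := pi_gt0 R.
rewrite -[leLHS]div1r ler_pdivrMr ?ltr0n//.
have -> : pi * cbin i ^+ 2 * i.+1%:R = (cbin i * (pi / 2)) ^+ 2 * i.*2.+2%:R * (pi / 2)^-1.
  have -> : i.*2.+2%:R = 2 * i.+1%:R :> R by rewrite -natrM; congr _%:R; lia.
  by clear w; move: pi0; move: (pi : R) => p p0; field; rewrite gt_eqF.
rewrite ler_pdivlMr ?divr_gt0// mul1r [leRHS]mulrC (le_trans w)//.
by rewrite ler_wpM2r ?sqr_ge0// ler_nat.
Qed.

Lemma cbin_sqr_le i : (0 < i)%N -> pi * cbin i ^+ 2 <= i%:R^-1.
Proof.
case: i => // i _.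
have w : i.*2.+2%:R * (cbin i.+1 * (pi / 2)) ^+ 2 <= pi / 2 :> R.
  rewrite -cbin_wallis -(wallis_prod i.*2.+1) doubleS expr2 -mulrA ler_wpM2l//.
  by rewrite ler_wpM2l ?wallis_anti ?ltW ?wallis_gt0.
have pi0 : 0 < pi :> R := pi_gt0 R.
rewrite -[leRHS]div1r ler_pdivlMr ?ltr0n//.
have -> : pi * cbin i.+1 ^+ 2 * i.+1%:R = (cbin i.+1 * (pi / 2)) ^+ 2 * i.*2.+2%:R * (pi / 2)^-1.
  have -> : i.*2.+2%:R = 2 * i.+1%:R :> R by rewrite -natrM; congr _%:R; lia.
  by clear w; move: pi0; move: (pi : R) => p p0; field; rewrite gt_eqF.
by rewrite ler_pdivrMr ?divr_gt0// mul1r mulrC.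
Qed.

(** A cruder bound than [cbin_sqr_le], which also covers [i = 0]. *)
Lemma cbin_sqr_le_odd i : cbin i ^+ 2 <= i.*2.+1%:R^-1.
Proof.
rewrite -[leRHS]div1r ler_pdivlMr ?ltr0n//.
elim: i => [|i IH].
  by rewrite /cbin double0 bin0 expr0 divr1 expr1n mulr1.
apply: le_trans IH.
have i2 : 0 < i.*2.+2%:R ^+ 2 :> R by rewrite exprn_gt0// ltr0n.
rewrite -(ler_pM2l i2).
have -> : i.*2.+2%:R ^+ 2 * (cbin i.+1 ^+ 2 * i.+1.*2.+1%:R) =
  cbin i ^+ 2 * (i.*2.+1%:R ^+ 2 * i.+1.*2.+1%:R).
  have := congr1 (fun z => z ^+ 2) (cbinS i); rewrite !exprMn => e.
  by rewrite [LHS]mulrA e; ring.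
have -> : i.*2.+2%:R ^+ 2 * (cbin i ^+ 2 * i.*2.+1%:R) =
  cbin i ^+ 2 * (i.*2.+2%:R ^+ 2 * i.*2.+1%:R) by ring.
rewrite ler_wpM2l ?sqr_ge0//.
by rewrite -!natrX -!natrM ler_nat; nia.
Qed.

Lemma bin_le_central k i : ('C(k.*2, i) <= 'C(k.*2, k))%N.
Proof.
have up j : (j <= k)%N -> ('C(k.*2, k - j) <= 'C(k.*2, k))%N.
  elim: j => [|j IH] jk; first by rewrite subn0.
  apply: leq_trans (IH (ltnW jk)); have := mul_bin_left k.*2 (k - j.+1).
  have -> : ((k - j.+1).+1 = k - j)%N by lia.
  move=> e; have k0 : (0 < k - j)%N by lia.
  rewrite -(leq_pmul2l k0) e leq_mul2r; apply/orP; right; lia.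
have [ik|ki] := leqP i k; first by rewrite -(subKn ik) up ?leq_subr.
have [i2k|] := leqP i k.*2; last by move=> h; rewrite bin_small.
rewrite -bin_sub// (_ : k.*2 - i = k - (i - k))%N; last by lia.
by rewrite up//; lia.
Qed.

End Wallis.

(** * Harmonic sums *)

Section Harmonic.
Variable R : realType.

Lemma inv_le_ln (a : nat) : (0 < a)%N ->
  a.+1%:R^-1 <= ln a.+1%:R - ln a%:R :> R.
Proof.
move=> a0; have a1 : 0 < a%:R :> R by rewrite ltr0n.
have a2 : 0 < a.+1%:R :> R by rewrite ltr0n.
have -> : ln a%:R = ln (a.+1%:R : R) + ln (1 + - a.+1%:R^-1).
  rewrite -lnM ?posrE//; last by rewrite subr_gt0 invf_lt1// ltr1n.
  by congr ln; rewrite -natr1 in a2 *; field; rewrite gt_eqF.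
rewrite opprD addrA subrr add0r lerNr.
by apply: le_ln1Dx; rewrite ltrN2 invf_lt1// ltr1n.
Qed.

Lemma ln_le_inv (a : nat) : (0 < a)%N ->
  ln a.+1%:R - ln a%:R <= a%:R^-1 :> R.
Proof.
move=> a0; have a1 : 0 < a%:R :> R by rewrite ltr0n.
rewrite -ln_div ?posrE ?ltr0n//.
have -> : a.+1%:R / a%:R = 1 + a%:R^-1 :> R by rewrite -natr1; field; rewrite gt_eqF.
by apply: le_ln1Dx; rewrite (@lt_trans _ _ 0)// invr_gt0.
Qed.

Lemma harmonic_le_ln (a k : nat) : (0 < a)%N ->
  \sum_(i < k) (a + i).+1%:R^-1 <= ln (a + k)%:R - ln a%:R :> R.
Proof.
move=> a0; elim: k => [|k IH]; first by rewrite big_ord0 addn0 subrr.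
rewrite big_ord_recr /= addnS.
apply: le_trans (lerD IH (inv_le_ln (ltn_addr k a0))) _.
by rewrite addrC subrKA.
Qed.

Lemma ln_le_harmonic k : ln k.+1%:R <= \sum_(i < k) i.+1%:R^-1 :> R.
Proof.
elim: k => [|k IH]; first by rewrite big_ord0 ln1.
rewrite big_ord_recr /=.
have := ln_le_inv (ltn0Sn k); rewrite lerBlDl => /le_trans; apply.
by rewrite lerD2r.
Qed.

Lemma harmonic_le k : \sum_(i < k.+1) i.+1%:R^-1 <= 1 + ln k.+1%:R :> R.
Proof.
rewrite big_ord_recl invr1 lerD2l.
have := harmonic_le_ln k (ltn0Sn 0); rewrite ln1 subr0 add1n; apply: le_trans.
by apply: ler_sum => i _; rewrite add1n.
Qed.

Lemma lnS_ge0 (n : nat) : 0 <= ln (n.+1%:R : R).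
Proof. by rewrite ln_ge0// ler1n. Qed.

Lemma ler_lnS (m n : nat) : (m <= n)%N -> ln (m.+1%:R : R) <= ln n.+1%:R.
Proof. by move=> mn; rewrite ler_ln ?posrE ?ltr0n// ler_nat. Qed.

End Harmonic.

(** * Simple random walk on the square lattice *)

Section Line.
Variable R : realType.
Implicit Types (u v : int -> R) (s : int).

(** One step of the simple random walk on the line. *)
Definition line_step u : int -> R := fun s => (u (s + 1) + u (s - 1)) / 2.

Lemma line_step_iter j u s : iter j line_step u s =
  \sum_(i < j.+1) 'C(j, i)%:R / 2 ^+ j * u (s + i.*2%:Z - j%:Z).
Proof.
elim: j s => [|j IH] s.
  by rewrite big_ord1 /= bin0 expr0 divr1 mul1r subr0 addr0.
rewrite /= /line_step !IH mulrDl !mulr_suml.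
rewrite [X in X + _](_ : _ = \sum_(i < j.+1) 'C(j, i)%:R / 2 ^+ j.+1 *
  u (s + i.+1.*2%:Z - j.+1%:Z)); last first.
  apply: eq_bigr => i _; rewrite exprS invfM [in RHS]mulrA.
  rewrite (_ : s + 1 + _ - _ = s + i.+1.*2%:Z - j.+1%:Z); first by ring.
  by lia.
rewrite [X in _ + X](_ : _ = \sum_(i < j.+1) 'C(j, i)%:R / 2 ^+ j.+1 *
  u (s + i.*2%:Z - j.+1%:Z)); last first.
  apply: eq_bigr => i _; rewrite exprS invfM [in RHS]mulrA.
  rewrite (_ : s - 1 + _ - _ = s + i.*2%:Z - j.+1%:Z); first by ring.
  by lia.
rewrite [in RHS]big_ord_recl [X in _ + X]big_ord_recl !bin0.
rewrite addrCA; congr (_ + _).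
under [in RHS]eq_bigr do rewrite binS natrD mulrDl mulrDl.
rewrite big_split /= addrC; congr (_ + _).
rewrite [in RHS]big_ord_recr /= bin_small// mul0r mul0r addr0.
by apply: eq_bigr.
Qed.

(** The indicator of a point of the line. *)
Definition delta s0 : int -> R := fun s => (s == s0)%:R.

(** At most one index of the binomial sum reaches the target. *)
Lemma line_step_delta_even k s0 s :
  iter k.*2 line_step (delta s0) s <= cbin R k.
Proof.
rewrite line_step_iter.
have [/existsP[i /eqP hi]|/existsPn h] :=
    boolP [exists i : 'I_k.*2.+1, s + i.*2%:Z - k.*2%:Z == s0].
  rewrite (bigD1 i)//= big1 => [|i' ii'].
    rewrite addr0 /delta hi eqxx mulr1 ler_wpM2r ?invr_ge0 ?exprn_ge0//.
    by rewrite ler_nat bin_le_central.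
  rewrite /delta; case: eqP => [e|_]; last by rewrite mulr0.
  by case/negP: ii'; rewrite -val_eqE /=; apply/eqP; lia.
rewrite big1 => [|i _]; first by rewrite ltW// cbin_gt0.
by rewrite /delta (negbTE (h i)) mulr0.
Qed.

Lemma line_step_delta_diag j s : iter j line_step (delta s) s =
  if odd j then 0 else cbin R j./2.
Proof.
rewrite line_step_iter; case: ifPn => oj.
  apply: big1 => i _; rewrite /delta; case: eqP => [e|_]; last by rewrite mulr0.
  by have : odd j = odd i.*2 by [congr odd; lia]; rewrite oj odd_double.
have j2 : j = j./2.*2 by rewrite -[LHS]odd_double_half (negbTE oj).
have hj : (j./2 < j.+1)%N by lia.
rewrite (bigD1 (Ordinal hj))//= big1 => [|i' ii'].
  rewrite addr0 /delta -j2 addrK eqxx mulr1 /cbin.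
  by rewrite -j2.
rewrite /delta; case: eqP => [e|_]; last by rewrite mulr0.
by case/negP: ii'; rewrite -val_eqE /=; apply/eqP; lia.
Qed.

Lemma line_step_delta_ge0 j s0 s : 0 <= iter j line_step (delta s0) s.
Proof.
rewrite line_step_iter; apply: sumr_ge0 => i _.
by rewrite mulr_ge0 ?divr_ge0 ?exprn_ge0.
Qed.

Lemma line_step_delta_le j s0 s : iter j line_step (delta s0) s <= cbin R j./2.
Proof.
rewrite -{1}[j]odd_double_half; case: (odd j); last first.
  by rewrite add0n line_step_delta_even.
rewrite add1n /= /line_step.
have := line_step_delta_even j./2 s0 (s + 1).
have := line_step_delta_even j./2 s0 (s - 1).
by lra.
Qed.

End Line.

Lemma ind_seq_le (R : realType) (V : eqType) (s : seq V) (x : V) :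
  ind R (mem s) x <= \sum_(y <- s) ind R (pred1 y) x.
Proof.
rewrite /ind; have [xs|] := boolP (mem s x); last first.
  by move=> _; apply: sumr_ge0 => y _; exact: ler0n.
elim: s xs => //= a s IH; rewrite inE big_cons => /predU1P[->|/IH h].
  by rewrite /= eqxx lerDl sumr_ge0// => y _; exact: ler0n.
by rewrite (le_trans h)// lerDr ler0n.
Qed.

Section Lattice.
Variable R : realType.
Implicit Types (f g : int * int -> R) (x y z : int * int).

(** One step of the simple random walk on the square lattice. *)
Definition lattice_step f : int * int -> R := fun z =>
  (f (z.1 + 1, z.2) + f (z.1 - 1, z.2) + f (z.1, z.2 + 1) + f (z.1, z.2 - 1)) / 4.

Lemma sub_markov_lattice : sub_markov lattice_step.
Proof.
split=> [a f g|f f0 x|x].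
- by apply/funext => x; rewrite /lattice_step; ring.
- by rewrite /lattice_step divr_ge0 ?addr_ge0.
- by rewrite /lattice_step; lra.
Qed.

Lemma lattice_step1 : lattice_step (fun=> 1) = fun=> 1.
Proof. by apply/funext => x; rewrite /lattice_step; field. Qed.

(** The sum and the difference of the coordinates of the lattice walk are
    independent walks on the line. *)
Lemma lattice_step_iter_diag j (u v : int -> R) :
  iter j lattice_step (fun z => u (z.1 + z.2) * v (z.1 - z.2)) =
  fun z => iter j (@line_step R) u (z.1 + z.2) * iter j (@line_step R) v (z.1 - z.2).
Proof.
elim: j => //= j ->; apply/funext => z; rewrite /lattice_step /line_step /=.
have -> : z.1 + 1 + z.2 = z.1 + z.2 + 1 by ring.
have -> : z.1 - 1 + z.2 = z.1 + z.2 - 1 by ring.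
have -> : z.1 + (z.2 + 1) = z.1 + z.2 + 1 by ring.
have -> : z.1 + (z.2 - 1) = z.1 + z.2 - 1 by ring.
have -> : z.1 + 1 - z.2 = z.1 - z.2 + 1 by ring.
have -> : z.1 - 1 - z.2 = z.1 - z.2 - 1 by ring.
have -> : z.1 - (z.2 + 1) = z.1 - z.2 - 1 by ring.
have -> : z.1 - (z.2 - 1) = z.1 - z.2 + 1 by ring.
by field.
Qed.

Lemma lattice_kernel j y z : iter j lattice_step (ind R (pred1 y)) z =
  iter j (@line_step R) (delta R (y.1 + y.2)) (z.1 + z.2) *
  iter j (@line_step R) (delta R (y.1 - y.2)) (z.1 - z.2).
Proof.
have -> : ind R (pred1 y) = fun z =>
    delta R (y.1 + y.2) (z.1 + z.2) * delta R (y.1 - y.2) (z.1 - z.2).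
  apply/funext => w; rewrite /ind /delta -natrM mulnb; congr (nat_of_bool _)%:R.
  case: w y => [a b] [c d] /=; apply/eqP/andP => [[-> ->]|[/eqP e1 /eqP e2]] //.
  by congr pair; lia.
by rewrite lattice_step_iter_diag.
Qed.

Lemma lattice_kernel_le j y z :
  iter j lattice_step (ind R (pred1 y)) z <= 2 * j.+1%:R^-1.
Proof.
rewrite lattice_kernel; apply: (@le_trans _ _ (cbin R j./2 ^+ 2)).
  by rewrite expr2 ler_pM ?line_step_delta_ge0 ?line_step_delta_le.
apply: le_trans (cbin_sqr_le_odd _ _) _.
rewrite -[leLHS]div1r ler_pdivrMr ?ltr0n// mulrAC ler_pdivlMr ?ltr0n//.
rewrite mul1r -natrM ler_nat.
by have := odd_double_half j; case: (odd j) => /=; lia.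
Qed.

(** The expected number of visits to the origin up to time [n], for the walk
    started there; time [0] counts. *)
Definition lattice_green n : R := green lattice_step n (ind R (pred1 (0, 0))) (0, 0).

Lemma lattice_green_diag n z :
  green lattice_step n (ind R (pred1 z)) z = lattice_green n.
Proof.
by apply: eq_bigr => i _; rewrite !lattice_kernel !line_step_delta_diag.
Qed.

(** Returns occur at even times only. *)
Lemma lattice_green_cbin n : lattice_green n = \sum_(i < n./2.+1) cbin R i ^+ 2.
Proof.
have even k : lattice_green k.*2 = \sum_(i < k.+1) cbin R i ^+ 2 /\
    lattice_green k.*2.+1 = \sum_(i < k.+1) cbin R i ^+ 2.
  have odd0 m : odd m -> lattice_green m.+1 = lattice_green m + cbin R m.+1./2 ^+ 2.
    move=> om; rewrite /lattice_green greenSr lattice_kernel !line_step_delta_diag.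
    by rewrite [odd m.+1]/= om expr2.
  have even0 m : ~~ odd m -> lattice_green m.+1 = lattice_green m.
    move=> om; rewrite /lattice_green greenSr lattice_kernel !line_step_delta_diag.
    by rewrite [odd m.+1]/= om mulr0 addr0.
  elim: k => [|k [_ IH]].
    have e0 : lattice_green 0 = \sum_(i < 1) cbin R i ^+ 2.
      by rewrite /lattice_green green0 big_ord1 /cbin double0 bin0
        expr0 divr1 expr1n.
    by split=> //; rewrite even0.
  have h : lattice_green k.+1.*2 = \sum_(i < k.+2) cbin R i ^+ 2.
    rewrite doubleS odd0 ?oddS ?odd_double// IH [RHS]big_ord_recr.
    by rewrite -doubleS doubleK.
  by split=> //; rewrite even0 ?odd_double.
rewrite -{1}[n]odd_double_half; case: (odd n); first by rewrite (even _).2.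
by rewrite add0n (even _).1.
Qed.

Lemma lattice_green_ge n : ln n.+1%:R - 1 <= pi * lattice_green n.
Proof.
rewrite lattice_green_cbin mulr_sumr.
apply: (@le_trans _ _ (\sum_(i < n./2.+1) i.+1%:R^-1)); last first.
  by apply: ler_sum => i _; exact: cbin_sqr_ge.
apply: le_trans (ln_le_harmonic _ _).
rewrite lerBlDr; apply: (@le_trans _ _ (ln (2 * n./2.+2%:R))).
  rewrite ler_ln ?posrE ?ltr0n ?mulr_gt0// -natrM ler_nat.
  by have := odd_double_half n; case: (odd n) => /=; lia.
rewrite lnM ?posrE// addrC lerD2l.
by have := @le_ln1Dx R 1; apply; lra.
Qed.

Lemma pi_le4 : pi <= 4 :> R.
Proof. by have := pihalf_lt2 R; lra. Qed.

Lemma lattice_green_le n : pi * lattice_green n <= ln n.+1%:R + 6.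
Proof.
rewrite lattice_green_cbin mulr_sumr big_ord_recl.
have -> : cbin R (@ord0 n./2) = 1 by rewrite /cbin double0 bin0 expr0 divr1.
rewrite expr1n mulr1.
have h : \sum_(i < n./2) pi * cbin R (lift ord0 i) ^+ 2 <= \sum_(i < n.+1) i.+1%:R^-1.
  apply: (@le_trans _ _ (\sum_(i < n./2) i.+1%:R^-1)).
    by apply: ler_sum => i _; exact: cbin_sqr_le.
  rewrite -!(big_mkord xpredT (fun i => i.+1%:R^-1)).
  rewrite [leRHS](big_cat_nat (n := n./2))//=; last by lia.
  by rewrite lerDl sumr_ge0.
by have := harmonic_le R n; have := pi_le4; lra.
Qed.

Lemma lattice_green_gt0 n : 0 < lattice_green n.
Proof.
rewrite lattice_green_cbin big_ord_recl ltr_wpDr//.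
  by apply: sumr_ge0 => i _; exact: sqr_ge0.
by rewrite exprn_gt0// cbin_gt0.
Qed.

Variable C : seq (int * int).

Let c : R := (size C)%:R.

Lemma lattice_visit_le j z :
  iter j lattice_step (ind R (mem C)) z <= 2 * c * j.+1%:R^-1.
Proof.
have hP := sub_markov_iter sub_markov_lattice j.
apply: le_trans (sm_mono hP (ind_seq_le R C) z) _; rewrite (sm_sum hP).
apply: le_trans (_ : \sum_(y <- C) 2 * j.+1%:R^-1 <= _).
  by apply: ler_sum => y _; exact: lattice_kernel_le.
by rewrite big_const_seq count_predT iter_addr_0 -[leLHS]mulr_natr mulrAC.
Qed.

Lemma lattice_green_set_le n z :
  green lattice_step n (ind R (mem C)) z <= 2 * c * (1 + ln n.+1%:R).
Proof.
apply: le_trans (_ : \sum_(j < n.+1) 2 * c * j.+1%:R^-1 <= _).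
  by apply: ler_sum => j _; exact: lattice_visit_le.
by rewrite -mulr_sumr ler_wpM2l ?mulr_ge0 ?ler0n// harmonic_le.
Qed.

(** Between the times [N] and [n], a finite set is visited at most of the order
    of [ln (n / N)] times on average, from any starting point. *)
Lemma lattice_green_diff_le N n z : (N <= n)%N ->
  green lattice_step n (ind R (mem C)) z <=
  green lattice_step N (ind R (mem C)) z + 2 * c * (ln n.+1%:R - ln N.+1%:R).
Proof.
move=> Nn; rewrite /green -!(big_mkord xpredT (fun j => iter j _ _ _)).
rewrite (big_cat_nat (n := N.+1))//= lerD2l.
rewrite -{1}[N.+1]add0n big_addn subSS big_mkord.
apply: le_trans (_ : \sum_(j < n - N) 2 * c * (N.+1 + j).+1%:R^-1 <= _).
  apply: ler_sum => j _; apply: le_trans (lattice_visit_le _ _) _.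
  by rewrite [(j + _)%N]addnC.
rewrite -mulr_sumr ler_wpM2l ?mulr_ge0 ?ler0n//.
have := @harmonic_le_ln R N.+1 (n - N) isT.
by rewrite addSn subnKC.
Qed.

End Lattice.

(** * Simple random walk on a graph *)

Section GraphStep.
Variables (R : realType) (G : sgraph).
Implicit Types (f : G -> R) (x y : G).

(** One step of the simple random walk on [G]. *)
Definition graph_step f : G -> R := fun x =>
  (degree x)%:R^-1 * \sum_(y <- fset_set (neighbours x)) f y.

Lemma sub_markov_graph : sub_markov graph_step.
Proof.
split=> [a f g|f f0 x|x].
- apply/funext => x; rewrite /graph_step big_split /= mulrDr -mulr_sumr.
  by rewrite mulrCA.
- by rewrite /graph_step mulr_ge0 ?invr_ge0 ?sumr_ge0.
- rewrite /graph_step big_const_seq count_predT iter_addr_0.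
  by rewrite /degree; case: #|` _| => [|n]; rewrite ?mulr0n ?mulr0// mulVf// pnatr_eq0.
Qed.

Hypothesis Gdeg : bounded_degrees G.

Lemma mem_neighbours x y : (y \in fset_set (neighbours x)) = adj x y.
Proof.
have [M /(_ x) [fx _]] := Gdeg.
by rewrite in_fset_set// /neighbours; apply/idP/idP; rewrite inE.
Qed.

Lemma graph_step1 : (forall x, exists y, adj x y) ->
  graph_step (fun=> 1) = fun=> 1.
Proof.
move=> h; apply/funext => x; rewrite /graph_step.
rewrite big_const_seq count_predT iter_addr_0 /degree mulVf//.
rewrite pnatr_eq0 cardfs_eq0; have [y xy] := h x.
by apply/fset0Pn; exists y; rewrite mem_neighbours.
Qed.

End GraphStep.

Lemma connected_has_neighbour (G : sgraph) : infinite_set [set: G] ->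
  connected_graph G -> forall x : G, exists y, adj x y.
Proof.
move=> Ginf Gconn x; apply: contrapT => h; apply: Ginf.
have -> : [set: G] = [set x].
  apply/seteqP; split => // y _; have [[|z p] /= + <-] := Gconn x y; first by [].
  by case/andP=> xz; case: h; exists z.
exact: finite_set1.
Qed.

(** * Charts *)

Section Chart.
Variable G : sgraph.

(** The neighbours of a point of the square lattice. *)
Definition lattice_nbrs (z : int * int) : seq (int * int) :=
  [:: (z.1 + 1, z.2); (z.1 - 1, z.2); (z.1, z.2 + 1); (z.1, z.2 - 1)].

Lemma mem_lattice_nbrs z w : (w \in lattice_nbrs z) = Z2_adj z w.
Proof.
case: z w => [a b] [c d]; rewrite /lattice_nbrs !inE !xpair_eqE /Z2_adj /=.
by apply/idP/idP; lia.
Qed.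

Lemma uniq_lattice_nbrs z : uniq (lattice_nbrs z).
Proof. by case: z => a b; rewrite /= !inE !xpair_eqE /=; lia. Qed.

Lemma lattice_stepE (R : realType) (f : int * int -> R) z :
  lattice_step f z = 4^-1 * \sum_(w <- lattice_nbrs z) f w.
Proof. by rewrite /lattice_step !big_cons big_nil addr0 /= mulrC !addrA. Qed.

(** Away from finitely many vertices, a finite modification of the lattice is
    read in the lattice through a map [psi] that turns one step of the walk on
    [G] into one step of the lattice walk.  The finite sets [B], [C] and [C0]
    are such that this holds off [B], that [C] is the preimage of [C0], that
    [psi] is injective off [C], and that a point of [C0] from which a step leads
    out of [C0] is the image of a vertex of [C] off [B]; the last property lets
    the walk on [G] leave [C] as the lattice walk leaves [C0]. *)
Record chart (psi : G -> int * int) (B C : seq G) (C0 : seq (int * int)) : Prop :=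
  Chart {
  chart_sub : {subset B <= C};
  chart_step : forall (R : realType) (f : int * int -> R) x, x \notin B ->
    graph_step (f \o psi) x = lattice_step f (psi x);
  chart_mem : forall x, (psi x \in C0) = (x \in C);
  chart_inj : {in [predC C] &, injective psi};
  chart_exit : forall z w, z \in C0 -> w \notin C0 -> Z2_adj z w ->
    exists y, [/\ y \in C, y \notin B & psi y = z];
  chart_origin : (0, 0) \in C0 }.

(** The isomorphism of a finite modification, extended by default values. *)
Lemma modification_bijection (o : G) : finite_modification Z2 G ->
  exists (D : {fset Z2}) (D' : {fset G}) (psi : G -> Z2) (phi : Z2 -> G),
  [/\ forall x, x \notin D' -> psi x \notin D /\ phi (psi x) = x,
      forall z, z \notin D -> phi z \notin D' /\ psi (phi z) = z &
      forall x y, x \notin D' -> y \notin D' -> Z2_adj (psi x) (psi y) = adj x y].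
Proof.
move=> [D [D' [f [g fK gK] fadj]]]; exists D, D'.
pose psi (x : G) : Z2 := if insub x is Some u then val (g u) else (0, 0).
pose phi (z : Z2) : G := if insub z is Some u then val (f u) else o.
have psiE x (hx : x \notin D') : psi x = val (g (Sub x hx)).
  by rewrite /psi insubT.
have phiE z (hz : z \notin D) : phi z = val (f (Sub z hz)).
  by rewrite /phi insubT.
exists psi, phi; split=> [x hx|z hz|x y hx hy].
- have h : psi x \notin D by rewrite psiE; exact: (valP (g _)).
  split=> //; rewrite phiE; have -> : Sub (psi x) h = g (Sub x hx).
    by apply: val_inj; rewrite /= psiE.
  by rewrite gK.
- have h : phi z \notin D' by rewrite phiE; exact: (valP (f _)).
  split=> //; rewrite psiE; have -> : Sub (phi z) h = f (Sub z hz).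
    by apply: val_inj; rewrite /= phiE.
  by rewrite fK.
- rewrite !psiE -[RHS]/(adj (Sub x hx : remove_vertices D') (Sub y hy)).
  by rewrite -[in RHS](gK (Sub x hx)) -[in RHS](gK (Sub y hy)) fadj.
Qed.

(** [B] gathers the vertices that the modification may affect, up to distance
    one, so that a vertex off [B] has the same four neighbours in [G] and in the
    lattice.  The set [C0] contains the image of [B], the removed points, the
    origin, which only makes it nonempty, and the neighbours of all these; [C]
    is the set of vertices read in [C0]. *)
Lemma chart_exists (o : G) : bounded_degrees G -> finite_modification Z2 G ->
  exists psi B C C0, chart psi B C C0.
Proof.
move=> Gdeg /(modification_bijection o) [D [D' [psi [phi [psiP phiP adjP]]]]].
pose nb (x : G) : seq G := fset_set (neighbours x).
pose B : seq G := enum_fset D' ++ flatten [seq nb d | d <- enum_fset D'] ++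
  [seq phi w | w <- flatten [seq lattice_nbrs d | d <- enum_fset D]].
pose B0 : seq Z2 := (0, 0) :: enum_fset D ++ map psi B.
pose C0 := B0 ++ flatten (map lattice_nbrs B0).
pose C := B ++ [seq phi z | z <- C0 & z \notin D].
have BD x : x \notin B -> x \notin D' by rewrite mem_cat negb_or => /andP[].
have BC : {subset B <= C} by move=> x xB; rewrite mem_cat xB.
exists psi, B, C, C0; split=> //.
- move=> R f x xB; have xD := BD _ xB.
  have nbD y : adj x y -> y \notin D'.
    move=> xy; apply: contra xB => yD; rewrite !mem_cat; apply/orP; right.
    apply/orP; left; apply/flattenP; exists (nb y); first exact: map_f.
    by rewrite mem_neighbours// adj_sym.
  have nbD0 w : Z2_adj (psi x) w -> w \notin D.
    move=> xw; apply: contra xB => wD; rewrite !mem_cat; apply/orP; right.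
    apply/orP; right; rewrite -(psiP _ xD).2; apply: map_f; apply/flattenP.
    exists (lattice_nbrs w); first exact: map_f.
    by rewrite mem_lattice_nbrs Z2_adj_sym.
  have perm : perm_eq (map psi (nb x)) (lattice_nbrs (psi x)).
    apply: uniq_perm; rewrite ?uniq_lattice_nbrs//.
      rewrite map_inj_in_uniq ?fset_uniq// => y y'.
      rewrite !mem_neighbours// => /nbD yD /nbD yD' e.
      by rewrite -(psiP _ yD).2 -(psiP _ yD').2 e.
    move=> w; rewrite mem_lattice_nbrs; apply/mapP/idP => [[y]|xw].
      rewrite mem_neighbours// => xy ->.
      by rewrite adjP// nbD.
    have [h1 h2] := phiP _ (nbD0 _ xw).
    exists (phi w); rewrite ?h2// mem_neighbours//.
    by rewrite -adjP// h2.
  have d4 : degree x = 4%N by rewrite -[RHS](perm_size perm) size_map.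
  by rewrite /graph_step d4 lattice_stepE -(perm_big _ perm)/= big_map.
- move=> x; apply/idP/idP.
    have [xB|xB xC0] := boolP (x \in B); first by rewrite BC.
    have [xD e] := psiP _ (BD _ xB).
    by rewrite mem_cat -e; apply/orP; right; apply: map_f; rewrite mem_filter xD.
  rewrite mem_cat => /orP[xB|/mapP[z]].
    by rewrite mem_cat inE mem_cat map_f// !orbT.
  by rewrite mem_filter => /andP[zD zC0] ->; rewrite (phiP _ zD).2.
- move=> x y xC yC e.
  have h z : z \in [predC C] -> z \notin D'.
    by move=> zC; apply: BD; apply: contra zC; exact: BC.
  by rewrite -(psiP _ (h _ xC)).2 e (psiP _ (h _ yC)).2.
- move=> z w zC wC zw.
  have zB : z \notin B0.
    apply: contra wC => zB; rewrite mem_cat; apply/orP; right; apply/flattenP.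
    by exists (lattice_nbrs z); rewrite ?mem_lattice_nbrs//; exact: map_f.
  have zD : z \notin D by apply: contra zB => zD; rewrite inE mem_cat zD orbT.
  have [_ pz] := phiP _ zD.
  exists (phi z); split=> //.
    by rewrite mem_cat; apply/orP; right; apply: map_f; rewrite mem_filter zD.
  apply: contra zB => zB; rewrite inE mem_cat -pz; apply/orP; right.
  by apply/orP; right; exact: map_f.
Qed.

End Chart.

(** * Comparison of the two walks *)

Section Transfer.
Variables (R : realType) (G : sgraph).
Variables (psi : G -> int * int) (B C : seq G) (C0 : seq (int * int)).
Hypothesis hchart : chart psi B C C0.

Let P := @graph_step R G.
Let L := @lattice_step R.
Let hP : sub_markov P := sub_markov_graph R G.
Let hL : sub_markov L := sub_markov_lattice R.

Let notB x : x \notin C -> x \notin B.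
Proof. by apply: contra; exact: (chart_sub hchart). Qed.

(** If [A] contains [C] and [A0] contains the image of [A], the lattice walk
    killed on [A0] is dominated by the walk on [G] killed on [A]. *)
Lemma transfer_ge (A : pred G) (A0 : pred (int * int)) f F n x :
  (forall y, y \in C -> A y) -> (forall y, A y -> A0 (psi y)) ->
  (forall z, 0 <= f z) -> (forall y, 0 <= F y) ->
  (forall y, y \notin B -> f (psi y) <= F y) ->
  x \notin B -> iter n (killed A0 L) f (psi x) <= iter n (killed A P) F x.
Proof.
move=> CA AA0 f0 F0 fF; elim: n x => [|n IH] x xB; first exact: fF.
rewrite -[leLHS]/(lattice_step (restr (predC A0) (iter n (killed A0 L) f)) (psi x)).
rewrite -(chart_step hchart _ xB); apply: (sm_mono hP) => y /=.
rewrite /restr /=; have [Ay|Ay] := boolP (A y); first by rewrite (AA0 _ Ay) /= !mul0r.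
rewrite [X in _ <= X]mul1r; case: (A0 (psi y)) => /=.
  rewrite mul0r.
  exact: (sub_markov_ge0 (sub_markov_iter (sub_markov_killed hP A) n)).
by rewrite mul1r; apply: IH; apply: notB; apply: contra Ay; exact: CA.
Qed.

(** The walk on [G] killed on [C] is dominated by the walk on the lattice. *)
Lemma transfer_le (f : G -> R) v n x : (forall z, 0 <= v z) ->
  (forall y, y \notin C -> f y <= v (psi y)) ->
  x \notin C -> iter n (killed (mem C) P) f x <= iter n L v (psi x).
Proof.
move=> v0 fv; elim: n x => [|n IH] x xC; first exact: fv.
rewrite -[leRHS]/(lattice_step (iter n L v) (psi x)).
rewrite -(chart_step hchart _ (notB xC)); apply: (sm_mono hP) => y /=.
rewrite /restr /=; have [yC|yC] := boolP (y \in C).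
  by rewrite mul0r; exact: (sub_markov_ge0 (sub_markov_iter hL n)).
by rewrite mul1r; exact: IH.
Qed.

Lemma transfer_green n x : x \notin C ->
  green (killed (mem C0) L) n (ind R (pred1 (psi x))) (psi x) <=
  green (killed (mem C) P) n (ind R (pred1 x)) x.
Proof.
move=> xC; apply: ler_sum => i _; apply: transfer_ge => //.
- by move=> y /=; rewrite (chart_mem hchart).
- move=> y yB; rewrite /ind /=; have [e|] := eqVneq (psi y) (psi x); last by rewrite ler0n.
  have yC : y \notin C by rewrite -(chart_mem hchart) e (chart_mem hchart).
  by rewrite (chart_inj hchart _ _ e)// eqxx.
- exact: notB.
Qed.

Lemma transfer_avoid n x : x \notin C ->
  iter n (killed (pred1 (psi x)) (killed (mem C0) L)) (fun=> 1) (psi x) <=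
  avoid P (pred1 x) n x.
Proof.
move=> xC; apply: (@le_trans _ _ (iter n (killed (predU (pred1 x) (mem C)) P) (fun=> 1) x)).
  rewrite killed_killed; apply: transfer_ge => //; last exact: notB.
  - by move=> y yC /=; rewrite yC orbT.
  - move=> y /= /orP[/eqP ->|yC]; first by rewrite eqxx.
    by rewrite (chart_mem hchart) yC orbT.
by apply: (killed_iter_le hP) => // y /= ->.
Qed.

(** A point of [C0] without neighbour off [C0] does not let the walk escape, and
    the other ones come from vertices where the two walks agree. *)
Lemma transfer_escape n z : z \in C0 -> 0 < avoid L (mem C0) n.+1 z ->
  exists2 y, y \in C & avoid L (mem C0) n.+1 z <= avoid P (mem C) n.+1 y.
Proof.
move=> zC0 pos.
have [/hasP[w zw wC]|/hasPn h] := boolP (has (fun w => w \notin C0) (lattice_nbrs z)).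
  rewrite mem_lattice_nbrs in zw.
  have [y [yC yB <-]] := chart_exit hchart zC0 wC zw.
  exists y => //; apply: transfer_ge => //.
  by move=> y' /=; rewrite (chart_mem hchart).
move: pos.
rewrite -[ltRHS]/(lattice_step (restr (predC (mem C0)) (avoid L (mem C0) n)) z).
rewrite lattice_stepE big_seq big1 ?mulr0 ?ltxx// => w zw.
by have := h _ zw; rewrite negbK /restr /= => ->; rewrite mul0r.
Qed.

End Transfer.

(** * Escape and visits *)

Section LatticeEstimates.
Variables (R : realType) (C0 : seq (int * int)).
Let L := @lattice_step R.
Let hL : sub_markov L := sub_markov_lattice R.
Let L1 : L (fun=> 1) = fun=> 1 := lattice_step1 R.
Let c0 : R := (size C0)%:R.

(** From some point of a finite set, the walk avoids the set for a time [n]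
    with probability at least of order [1 / ln n]. *)
Lemma lattice_escape n : (0, 0) \in C0 -> exists2 z, z \in C0 &
  1 <= avoid L (mem C0) n z * (4 * c0 * (1 + ln (4 * size C0 * n).+1%:R)).
Proof.
(* With this value of [M], the last visit to [C0] up to time [M + n] occurs
   after time [M] with probability less than one half. *)
move=> C0o; set M := (4 * size C0 * n)%N; set K := _ * (1 + _).
have c1 : 1 <= c0 by rewrite ler1n; case: (C0) C0o.
have c0_gt0 : 0 < c0 by exact: lt_le_trans c1.
have K0 : 0 < K by rewrite /K !mulr_gt0// ltr_pwDl// lnS_ge0.
apply: contrapT => /forall2NP h.
have {}h z : z \in C0 -> avoid L (mem C0) n z <= K^-1.
  move=> zC; have [//|/negP] := h z; rewrite -ltNge => hz.
  by rewrite -[leRHS]div1r ler_pdivlMr// ltW.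
have := green_avoid_ge1 hL L1 M n (A := mem C0) C0o.
apply/negP; rewrite -ltNge.
have h1 : green L M (restr (mem C0) (avoid L (mem C0) n)) (0, 0) <= 2^-1.
  apply: (@le_trans _ _ (green L M (fun z => K^-1 * ind R (mem C0) z) (0, 0))).
    apply: (green_mono hL) => z; rewrite /restr /ind mulrC /=.
    by case: (boolP (z \in C0)) => zC; rewrite ?mulr0 ?mulr1//; exact: h.
  rewrite (greenZ hL) mulrC ler_pdivrMr//.
  apply: le_trans (lattice_green_set_le R C0 M (0, 0)) _.
  by rewrite /K -/c0 le_eqVlt; apply/orP; left; apply/eqP; field.
have h2 : \sum_(i < n) iter (M + i).+1 L (ind R (mem C0)) (0, 0) < 2^-1.
  apply: (@le_lt_trans _ _ (\sum_(i < n) 2 * c0 * M.+1%:R^-1)).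
    apply: ler_sum => i _; apply: le_trans (lattice_visit_le R C0 _ _) _.
    rewrite ler_wpM2l ?mulr_ge0 ?ler0n//.
    by rewrite lef_pV2 ?posrE ?ltr0n// ler_nat; lia.
  rewrite sumr_const card_ord -[ltLHS]mulr_natr [ltLHS]mulrAC ltr_pdivrMr ?ltr0n//.
  rewrite [ltRHS]mulrC ltr_pdivlMr// /c0 -!natrM ltr_nat /M.
  by lia.
by lra.
Qed.

(** The function [green L N (ind C0)], the mean number of visits to [C0] up to
    time [N], exceeds [1] at the bad points; this bounds the time spent at these
    without counting them. *)
Lemma lattice_green_green_le N n z :
  green L n (green L N (ind R (mem C0))) z <=
  N.+1%:R * (2 * c0 * (1 + ln n.+1%:R)).
Proof.
rewrite (_ : green L N _ = fun y => \sum_(j < N.+1) iter j L (ind R (mem C0)) y)//.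
rewrite (green_sum hL).
apply: (@le_trans _ _ (\sum_(j < N.+1) 2 * c0 * (1 + ln n.+1%:R))); last first.
  by rewrite sumr_const card_ord -[leLHS]mulr_natl.
apply: ler_sum => j _.
apply: (@le_trans _ _ (\sum_(i < n.+1) 2 * c0 * i.+1%:R^-1)); last first.
  by rewrite -mulr_sumr ler_wpM2l ?mulr_ge0 ?ler0n// harmonic_le.
apply: ler_sum => i _; rewrite -iterD.
apply: le_trans (lattice_visit_le R C0 _ _) _.
by rewrite ler_wpM2l ?mulr_ge0 ?ler0n// lef_pV2 ?posrE ?ltr0n// ler_nat; lia.
Qed.

(** A bound on the number of visits to [C0] up to time [N] bounds the probability
    of hitting [C0] before a larger time [m]. *)
Lemma lattice_hit_le N m z : (N <= m + m)%N ->
  green L N (ind R (mem C0)) z <= 1 ->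
  hit L (mem C0) m z * lattice_green R m <=
  1 + 2 * c0 * (ln (m + m).+1%:R - ln N.+1%:R).
Proof.
move=> Nm uz.
apply: le_trans (_ : green L (m + m) (ind R (mem C0)) z <= _).
  apply: (hit_green hL L1) => b Cb; rewrite -(lattice_green_diag _ m b).
  apply: (green_mono hL) => y; rewrite /ind /=.
  by have [->|] := eqVneq y b; rewrite ?ler0n//; have -> : b \in C0 by [].
by apply: le_trans (lattice_green_diff_le R C0 z Nm) _; rewrite lerD2r.
Qed.

Lemma lattice_green_point_le n y z :
  green L n (ind R (pred1 y)) z <= 2 * (1 + ln n.+1%:R).
Proof.
have := lattice_green_set_le R [:: y] n z; rewrite mulr1; apply: le_trans.
by apply: (green_mono hL) => x; rewrite /ind /= inE.
Qed.

(** Killing the walk on a set that is unlikely to be hit does not change much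
    the mean number of returns. *)
Lemma lattice_green_killed_ge m z :
  lattice_green R m <= green (killed (mem C0) L) m (ind R (pred1 z)) z +
    hit L (mem C0) m z * (2 * (1 + ln m.+1%:R)).
Proof.
rewrite -(lattice_green_diag R m z).
apply: (green_killed_ge hL L1) => y; first exact: ind_ge0.
by move=> _; exact: lattice_green_point_le.
Qed.

(** A lower bound for the probability of no return within [n] steps, which is
    sharp when [l] is large but [ln l] is negligible with respect to [ln n]. *)
Lemma lattice_avoid_ge l n z :
  1 - 2 * n%:R / (l * n).+1%:R <= avoid L (pred1 z) n z * lattice_green R (l * n).
Proof.
have := green_avoid_ge1 hL L1 (l * n) n (A := pred1 z) (eqxx z).
rewrite (_ : restr _ _ = fun y => avoid L (pred1 z) n z * ind R (pred1 z) y); last first.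
  by apply/funext => y; exact: avoid_pred1.
rewrite (greenZ hL) lattice_green_diag => h.
rewrite lerBlDr (le_trans h)// lerD2l.
apply: (@le_trans _ _ (\sum_(i < n) 2 * (l * n).+1%:R^-1)).
  apply: ler_sum => i _; apply: le_trans (lattice_kernel_le R _ _ _) _.
  by rewrite ler_wpM2l// lef_pV2 ?posrE ?ltr0n// ler_nat; lia.
by rewrite sumr_const card_ord -[leLHS]mulr_natr mulrAC.
Qed.

End LatticeEstimates.

(** * Estimates on a chart *)

Section GraphEstimates.
Variables (R : realType) (G : sgraph).
Variables (psi : G -> int * int) (B C : seq G) (C0 : seq (int * int)).
Hypothesis hchart : chart psi B C C0.

Let P := @graph_step R G.
Let L := @lattice_step R.
Let hP : sub_markov P := sub_markov_graph R G.
Let hL : sub_markov L := sub_markov_lattice R.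
Let L1 : L (fun=> 1) = fun=> 1 := lattice_step1 R.
Let c0 : R := (size C0)%:R.

Hypothesis P1 : P (fun=> 1) = fun=> 1.
Hypothesis Gconn : connected_graph G.
Hypothesis Gdeg : bounded_degrees G.

Lemma graph_kernel_gt0 (x y : G) : exists k, 0 < iter k P (ind R (pred1 y)) x.
Proof.
have [p + <-] := Gconn x y; elim: p x => [|z p IH] x /=.
  by move=> _; exists 0%N; rewrite /ind /= eqxx.
case/andP=> xz /IH [k hk]; exists k.+1; rewrite iterS /P /graph_step.
have zx : z \in fset_set (neighbours x) by rewrite mem_neighbours.
rewrite mulr_gt0 ?invr_gt0 ?ltr0n ?cardfs_gt0//; first by apply/fset0Pn; exists z.
rewrite (big_rem _ zx)/= ltr_wpDr// sumr_ge0// => w _.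
by apply: (iter_ge0 hP) => v; exact: ind_ge0.
Qed.

Lemma green_shift_le n k (f : G -> R) x : (forall y, 0 <= f y) ->
  green P n (iter k P f) x <= green P (n + k) f x.
Proof.
move=> f0; elim: n => [|n IH].
  rewrite green0 add0n; case: k => [|k]; first by rewrite green0.
  by rewrite greenSr lerDr (green_ge0 hP).
by rewrite addSn !greenSr -iterD addSn lerD2r.
Qed.

(** Visits to [y] are followed by visits to [y'] with a fixed probability. *)
Lemma green_compare (y y' : G) : exists k p, 0 < p /\ forall n x,
  p * green P n (ind R (pred1 y)) x <= green P (n + k) (ind R (pred1 y')) x.
Proof.
have [k hk] := graph_kernel_gt0 y y'.
exists k, (iter k P (ind R (pred1 y')) y); split=> // n x.
apply: le_trans (green_shift_le _ _ _ _); last by move=> z; exact: ind_ge0.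
rewrite -(greenZ hP); apply: (green_mono hP) => z; rewrite /ind /=.
have [->|_] := eqVneq z y; first by rewrite mulr1.
by rewrite mulr0; apply: (iter_ge0 hP) => w; exact: ler0n.
Qed.

Lemma green_compare_unif (s : seq (G * G)) : exists k p, 0 < p /\
  forall y y' n x, (y, y') \in s ->
  p * green P n (ind R (pred1 y)) x <= green P (n + k) (ind R (pred1 y')) x.
Proof.
elim: s => [|[y1 y2] s [k [p [p0 IH]]]]; first by exists 0%N, 1.
have [k' [p' [p'0 h]]] := green_compare y1 y2.
exists (k + k')%N, (Num.min p p'); split; first by rewrite lt_min p0.
have g0 n z x : 0 <= green P n (ind R (pred1 z)) x.
  by apply: (green_ge0 hP) => w; exact: ind_ge0.
move=> y y' n x; rewrite inE => /predU1P[[-> ->]|/(IH _ _ n x) le].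
  apply: le_trans (_ : p' * green P n (ind R (pred1 y1)) x <= _).
    by rewrite ler_wpM2r// ge_min lexx orbT.
  apply: le_trans (h _ _) _; apply: (green_leS hP); first by lia.
  by move=> w; exact: ind_ge0.
apply: le_trans (_ : p * green P n (ind R (pred1 y)) x <= _).
  by rewrite ler_wpM2r// ge_min lexx.
apply: le_trans le _; apply: (green_leS hP); first by lia.
by move=> w; exact: ind_ge0.
Qed.

Let c1 : 1 <= c0.
Proof. by rewrite ler1n; case: (C0) (chart_origin hchart). Qed.

Let c0_gt0 : 0 < c0. Proof. exact: lt_le_trans c1. Qed.

(** The time spent in [C] is at most of order [ln n]: some vertex of [C] is
    left for a time [n] with probability at least of order [1 / ln n], and it
    can be reached from all the others. *)
Lemma green_core_le : exists2 K : R, 0 < K & forall n x,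
  green P n (ind R (mem C)) x <= K * (1 + ln n.+1%:R).
Proof.
have [k [p [p0 hkp]]] := green_compare_unif [seq (y, y') | y <- C, y' <- C].
pose a := (4 * size C0 * k.+1).+1.
pose K := (size C)%:R / p * (4 * c0 * (1 + ln a%:R)) + 1 : R.
have a1 : 0 <= ln a%:R :> R by exact: lnS_ge0.
have K0 : 0 <= (size C)%:R / p * (4 * c0 * (1 + ln a%:R)).
  by rewrite !mulr_ge0 ?invr_ge0 ?addr_ge0// ltW.
exists K; first by rewrite ltr_wpDl.
move=> n x; set m := (n + k)%N.
have [z zC0 hz] := lattice_escape R m.+1 (chart_origin hchart).
rewrite -/L -/c0 in hz.
have pos : 0 < avoid L (mem C0) m.+1 z.
  rewrite lt_neqAle (avoid_ge0 hL) andbT; apply/eqP => e.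
  by move: hz; rewrite -e mul0r ler10.
have [y yC hy] := transfer_escape hchart zC0 pos.
have {hz} gy : green P m (ind R (pred1 y)) x <= 4 * c0 * (1 + ln (4 * size C0 * m.+1).+1%:R).
  set D := 4 * c0 * _ in hz *.
  have D0 : 0 <= D by rewrite /D !mulr_ge0 ?addr_ge0 ?lnS_ge0// ltW.
  have gP0 i : 0 <= green P i (ind R (pred1 y)) x.
    by apply: (green_ge0 hP) => w; exact: ind_ge0.
  have av1 : avoid P (mem C) m.+1 y * green P m (ind R (pred1 y)) x <= 1.
    apply: le_trans (green_avoid_le1 hP P1 (mem C) m.+1 x).
    rewrite -(greenZ hP).
    apply: (@le_trans _ _ (green P m (restr (mem C) (avoid P (mem C) m.+1)) x)).
      apply: (green_mono hP) => w; rewrite /restr /ind /=.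
      have [->|_] := eqVneq w y; first by rewrite yC mulr1 mul1r.
      by rewrite mulr0 mulr_ge0//; exact: (avoid_ge0 hP (mem C) m.+1).
    by apply: (green_leS hP) => // w; rewrite mulr_ge0//; exact: (avoid_ge0 hP).
  have : 1 <= avoid P (mem C) m.+1 y * D by apply: le_trans hz _; rewrite ler_wpM2r.
  set g := green _ _ _ _ in av1 gP0 *; set v := avoid _ _ _ _ in av1 * => vD.
  apply: (@le_trans _ _ (g * (v * D))).
    by rewrite ler_peMr//; exact: gP0.
  by rewrite mulrA [g * v]mulrC ler_piMl.
apply: (@le_trans _ _ ((size C)%:R / p * (4 * c0 * (1 + ln (4 * size C0 * m.+1).+1%:R)))).
  apply: le_trans (green_mono hP n (ind_seq_le R C) x) _.
  rewrite (green_sum hP) big_seq.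
  apply: le_trans (_ : \sum_(y' <- C | y' \in C) p^-1 * green P m (ind R (pred1 y)) x <= _).
    apply: ler_sum => y' y'C; rewrite ler_pdivlMl//; apply: hkp.
    by apply/allpairsP; exists (y', y).
  rewrite -big_seq big_const_seq count_predT iter_addr_0 -[leLHS]mulr_natl mulrA.
  by rewrite ler_wpM2l// divr_ge0// ltW.
have ln_le : ln (4 * size C0 * m.+1).+1%:R <= ln n.+1%:R + ln a%:R :> R.
  rewrite -lnM ?posrE ?ltr0n// ler_ln ?posrE ?mulr_gt0 ?ltr0n// -natrM ler_nat.
  by rewrite /a /m; nia.
have n1 : 0 <= ln n.+1%:R :> R by exact: lnS_ge0.
apply: (@le_trans _ _ ((size C)%:R / p * (4 * c0 * (1 + ln a%:R)) * (1 + ln n.+1%:R))); last first.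
  by rewrite ler_wpM2r ?addr_ge0// lerDl.
rewrite -[leRHS]mulrA ler_wpM2l ?divr_ge0 ?(ltW p0)//.
rewrite -[leRHS]mulrA ler_wpM2l ?mulr_ge0 ?(ltW c0_gt0)//.
have : 0 <= ln a%:R * ln n.+1%:R :> R by rewrite mulr_ge0.
by rewrite mulrDr !mulrDl !mul1r; lra.
Qed.

(** The vertices of [C], and those from which the lattice walk makes on average
    more than one visit to [C0] up to time [N]. *)
Definition bad_vertex N : pred G := fun x =>
  (x \in C) || (1 < green L N (ind R (mem C0)) (psi x)).

Lemma green_bad_le : exists2 K : R, 0 < K & forall N n x,
  green P n (ind R (bad_vertex N)) x <= K * N.+1%:R * (1 + ln n.+1%:R) ^+ 2.
Proof.
have [K K0 hK] := green_core_le.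
pose K' : R := K + 2 * c0 * (1 + K).
exists K'; first by rewrite addr_gt0// !mulr_gt0// addr_gt0.
move=> N n x.
pose A : pred G := fun y => (y \notin C) && bad_vertex N y.
set l := 1 + ln n.+1%:R.
have l1 : 1 <= l by rewrite lerDl lnS_ge0.
have N1 : 1 <= N.+1%:R :> R by rewrite ler1n.
pose U : R := N.+1%:R * (2 * c0 * l).
have l_gt0 : 0 < l by exact: lt_le_trans l1.
have U0 : 0 <= U by rewrite ltW// !mulr_gt0// ltr0n.
have hC := sub_markov_killed hP (mem C).
have u0 z : 0 <= green L N (ind R (mem C0)) z.
  by apply: (green_ge0 hL) => w; exact: ind_ge0.
(* Off [C] the killed walk is dominated by the lattice walk; from a vertex of
   [C] the first step leads off [C] or kills the walk. *)
have offC m y : (m <= n)%N -> y \notin C -> green (killed (mem C) P) m (ind R A) y <= U.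
  move=> mn yC; apply: (@le_trans _ _ (green (killed (mem C) P) n (ind R A) y)).
    by apply: (green_leS hC) => // w; exact: ind_ge0.
  apply: le_trans (lattice_green_green_le R C0 N n (psi y)).
  apply: ler_sum => i _; apply: (transfer_le hchart) => // w wC.
  rewrite /ind /A /bad_vertex wC (negbTE wC) /=.
  by case: ltP => [/ltW//|_]; exact: u0.
have onC y : green (killed (mem C) P) n (ind R A) y <= U.
  have [yC|] := boolP (y \in C); last exact: offC.
  have Ay : ind R A y = 0 by rewrite /ind /A yC.
  case: (n) offC => [|m] offC; first by rewrite green0 Ay.
  rewrite (greenS hC) Ay add0r; apply: (sm_le_cst hP) => // w.
  rewrite /restr /=; have [wC|wC] := boolP (w \in C); first by rewrite mul0r.
  by rewrite mul1r; apply: offC.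
have gA : green P n (ind R A) x <= U + U * (K * l).
  apply: le_trans (green_le_killed hP (C := mem C) x U0 _ _) _.
  - by move=> y; exact: ind_ge0.
  - by move=> y _; exact: onC.
  apply: lerD; first exact: onC.
  rewrite ler_wpM2l// (le_trans _ (hK n x))// gerBl; exact: ind_ge0.
have -> : ind R (bad_vertex N) = fun y => ind R (mem C) y + ind R A y.
  apply/funext => y; rewrite /ind /A /bad_vertex /=.
  by case: (y \in C); rewrite ?addr0 ?add0r.
rewrite (greenD hP); apply: le_trans (lerD (hK n x) gA) _; rewrite -/l.
have h1 : K * l <= K * N.+1%:R * l ^+ 2.
  rewrite -[leRHS]mulrA ler_pM2l//; apply: (@le_trans _ _ (l ^+ 2)).
    by rewrite expr2 ler_peMr// ltW.
  by rewrite ler_peMl// sqr_ge0.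
have h2 : U <= 2 * c0 * N.+1%:R * l ^+ 2.
  have -> : U = 2 * c0 * N.+1%:R * l by rewrite /U; ring.
  by rewrite expr2 [leRHS]mulrA ler_peMr// ltW// !mulr_gt0// ltr0n.
have -> : U * (K * l) = 2 * c0 * K * N.+1%:R * l ^+ 2 by rewrite /U; ring.
have -> : K' * N.+1%:R * l ^+ 2 = K * N.+1%:R * l ^+ 2 +
    (2 * c0 * N.+1%:R * l ^+ 2 + 2 * c0 * K * N.+1%:R * l ^+ 2) by rewrite /K'; ring.
by rewrite !lerD.
Qed.

End GraphEstimates.

(** * The mean range *)

Section MeanRange.
Variables (R : realType) (V : eqType) (P : (V -> R) -> V -> R).
Hypothesis hP : sub_markov P.

(** The probability from [x] of not returning to [x] within [n] steps. *)
Definition no_return n : V -> R := fun x => avoid P (pred1 x) n x.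

(** The mean number of points visited up to time [n] from [x], each point being
    counted at its last visit. *)
Definition mean_range n x : R := \sum_(k < n.+1) iter k P (no_return (n - k)) x.

Lemma no_return_ge0 n x : 0 <= no_return n x. Proof. exact: avoid_ge0. Qed.

Lemma no_return_le1 n x : no_return n x <= 1. Proof. exact: avoid_le1. Qed.

Lemma no_return_anti m n x : (m <= n)%N -> no_return n x <= no_return m x.
Proof. exact: avoid_anti. Qed.

Lemma sum_ltn_le (N m : nat) : \sum_(j < m) (j < N)%N%:R <= N%:R :> R.
Proof.
suff -> : \sum_(j < m) (j < N)%N%:R = (minn m N)%:R :> R by rewrite ler_nat geq_minr.
elim: m => [|m IH]; first by rewrite big_ord0 min0n.
by rewrite big_ord_recr /= IH -natrD; congr _%:R; lia.
Qed.

(** The last [N] steps and the visits to the bad set [A] are counted entirely. *)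
Lemma mean_range_le (A : pred V) N n a x : 0 <= a ->
  (forall y, ~~ A y -> no_return N y <= a) ->
  mean_range n x <= N%:R + green P n (ind R A) x + n.+1%:R * a.
Proof.
move=> a0 hA.
have le_k (k : 'I_n.+1) : iter k P (no_return (n - k)) x <=
    (n - k < N)%N%:R + iter k P (ind R A) x + a.
  have [lt_N|ge_N] := ltnP (n - k) N.
    apply: (@le_trans _ _ 1); last first.
      rewrite -addrA lerDl addr_ge0//; apply: (iter_ge0 hP) => y; exact: ind_ge0.
    by apply: (sm_le_cst (sub_markov_iter hP k)) => // y; exact: no_return_le1.
  rewrite add0r; apply: (@le_trans _ _ (iter k P (fun y => ind R A y + a) x)).
    apply: (iter_mono hP) => y; rewrite /ind.
    case: (boolP (A y)) => Ay.
      by rewrite (le_trans (no_return_le1 _ _))// lerDl.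
    by rewrite add0r (le_trans (no_return_anti y ge_N))// hA.
  rewrite (smD (sub_markov_iter hP k)) lerD2l.
  exact: (sm_le_cst (sub_markov_iter hP k)).
apply: le_trans (ler_sum _ (fun k _ => le_k k)) _.
rewrite !big_split /= sumr_const card_ord -[X in _ + X <= _]mulr_natl !lerD2r.
rewrite (reindex_inj rev_ord_inj) /=; apply: le_trans (sum_ltn_le N n.+1).
by apply: ler_sum => i _; rewrite subSS subKn// -ltnS.
Qed.

Hypothesis P1 : P (fun=> 1) = fun=> 1.

Lemma mean_range_ge (A : pred V) n b x : 0 <= b ->
  (forall y, ~~ A y -> b <= no_return n y) ->
  b * (n.+1%:R - green P n (ind R A) x) <= mean_range n x.
Proof.
move=> b0 hA.
have -> : b * (n.+1%:R - green P n (ind R A) x) =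
    green P n (fun y => b * (-1 * ind R A y + 1)) x.
  rewrite (greenZ hP) (greenD hP) (greenZ hP) mulN1r addrC; congr (_ * (_ + _)).
  rewrite /green; under eq_bigr do rewrite (iter1 P1).
  by rewrite sumr_const card_ord.
apply: ler_sum => k _; apply: (iter_mono hP) => y.
apply: le_trans (no_return_anti y (leq_subr k n)).
rewrite /ind; case: (boolP (A y)) => Ay.
  by rewrite mulN1r addNr mulr0 no_return_ge0.
by rewrite mulr0 add0r mulr1 hA.
Qed.

End MeanRange.

Section GoodVertices.
Variables (R : realType) (G : sgraph).
Variables (psi : G -> int * int) (B C : seq G) (C0 : seq (int * int)).
Hypothesis hchart : chart psi B C C0.

Let P := @graph_step R G.
Let L := @lattice_step R.
Let hP : sub_markov P := sub_markov_graph R G.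
Let hL : sub_markov L := sub_markov_lattice R.
Let L1 : L (fun=> 1) = fun=> 1 := lattice_step1 R.
Let c0 : R := (size C0)%:R.

Hypothesis P1 : P (fun=> 1) = fun=> 1.

(** A bound for the probability of hitting [C0] within [m] steps from a good
    vertex; [c] stands for the size of [C0]. *)
Definition hit_bound (c : R) N m : R :=
  (1 + 2 * c * (ln (m + m).+1%:R - ln N.+1%:R)) / lattice_green R m.

(** A lower bound for the mean number of visits to a good vertex up to time [m],
    for the walk killed on [C]. *)
Definition killed_green_bound (c : R) N m : R :=
  lattice_green R m - hit_bound c N m * (2 * (1 + ln m.+1%:R)).

Variables (N : nat) (x : G).
Hypothesis good : ~~ bad_vertex R psi C C0 N x.

Let xC : x \notin C. Proof. by move: good; rewrite negb_or => /andP[]. Qed.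

Lemma hit_good_le m : (N <= m + m)%N ->
  hit L (mem C0) m (psi x) <= hit_bound c0 N m.
Proof.
move=> Nm; rewrite ler_pdivlMr ?lattice_green_gt0//.
by apply: lattice_hit_le => //; move: good; rewrite negb_or -leNgt => /andP[].
Qed.

Lemma killed_green_good_ge m : (N <= m + m)%N ->
  killed_green_bound c0 N m <=
  green (killed (mem C0) L) m (ind R (pred1 (psi x))) (psi x).
Proof.
move=> Nm; rewrite lerBlDr; apply: le_trans (lattice_green_killed_ge R C0 m (psi x)) _.
by rewrite lerD2l ler_wpM2r ?hit_good_le// mulr_ge0// addr_ge0// lnS_ge0.
Qed.

Lemma no_return_good_le : no_return P N x * killed_green_bound c0 N N <= 1.
Proof.
apply: le_trans (avoid_green_le1 hP P1 x N); rewrite ler_wpM2l ?(avoid_ge0 hP)//.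
apply: le_trans (killed_green_good_ge _) _; first by rewrite leq_addr.
apply: le_trans (transfer_green R hchart N xC) _.
apply: ler_sum => i _; apply: (iter_killed_le hP) => y; exact: ind_ge0.
Qed.

Lemma no_return_good_ge l n : (N <= n)%N -> 0 < killed_green_bound c0 N n ->
  (1 - 2 * n%:R / (l * n).+1%:R) / lattice_green R (l * n) -
    hit_bound c0 N (n + n) / killed_green_bound c0 N n <= no_return P n x.
Proof.
move=> Nn pos; apply: le_trans (transfer_avoid R hchart n xC).
have psiC : ~~ (mem C0) (psi x) by rewrite /= (chart_mem hchart).
have := avoid_killed_ge hL L1 n psiC.
have := lattice_avoid_ge R l n (psi x).
rewrite -ler_pdivrMr ?lattice_green_gt0//.
set q := avoid _ _ _ _; set k := iter _ _ _ _ => h1 h2.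
have {}h2 : q - k <= hit_bound c0 N (n + n) / killed_green_bound c0 N n.
  have [qk|qk] := leP (q - k) 0.
    apply: le_trans qk _; rewrite divr_ge0 ?(ltW pos)//.
    by apply: le_trans (hit_good_le (m := n + n) _); [exact: hit_ge0|lia].
  rewrite ler_pdivlMr//; apply: le_trans (hit_good_le (m := n + n) _); last by lia.
  apply: le_trans h2; rewrite ler_wpM2l ?(ltW qk)//.
  by apply: killed_green_good_ge; lia.
by rewrite lerBlDr (le_trans h1)// -lerBlDl.
Qed.

End GoodVertices.

(** * Asymptotics of the mean range *)

Section Sandwich.
Variables (R : realType) (G : sgraph).
Variables (psi : G -> int * int) (B C : seq G) (C0 : seq (int * int)).
Hypothesis hchart : chart psi B C C0.

Let P := @graph_step R G.
Let hP : sub_markov P := sub_markov_graph R G.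
Let c0 : R := (size C0)%:R.

Hypothesis P1 : P (fun=> 1) = fun=> 1.

Variable K : R.
Hypothesis K_ge0 : 0 <= K.
Hypothesis green_bad : forall N n x,
  green P n (ind R (bad_vertex R psi C C0 N)) x <=
  K * N.+1%:R * (1 + ln n.+1%:R) ^+ 2.

(** The bounds on [ln n / n] times the mean range are expressed through two small
    parameters: [d], which bounds the relative deviation from [ln n] of the
    logarithms of the times that occur, and [e], the inverse of [ln n].  As [d]
    and [e] tend to [0], [gap] tends to [1 / pi] and the others tend to [pi]. *)
Let c1 : R := pi * (1 + 2 * c0).
Definition gap d : R := (1 - d) / pi - c1 * d / (1 - d) * (2 * (1 + d)).
Definition upper d e : R := e + 2 * K * (1 + d) ^+ 2 * e + (1 + e) / gap d.
Definition low d e : R := (1 - 2 * e) * pi / (1 + d) - c1 * d / (1 - d) / gap d.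
Definition lower d e : R := low d e * (1 - 2 * K * (1 + d) ^+ 2 * e).

(** The ratio [l] between [n] and the time [N] is at least [(ln n) ^ 4], so that
    [N * (ln n) ^ 2] is negligible with respect to [n / ln n], while [ln l] is
    at most [d * ln n]. *)
Variables (n l : nat) (d : R).
Let t : R := ln n%:R.
Let N := (n %/ l)%N.

Hypothesis l_le_n : (l <= n)%N.
Hypothesis t_ge2 : 2 <= t.
Hypothesis l_ge : t ^+ 4 <= l%:R.
Hypothesis d_le : d <= 2^-1.
Hypothesis ln_l : 9 + ln l%:R <= d * t.
Hypothesis gap_gt0 : 0 < gap d.

Let pi0 : 0 < pi :> R. Proof. exact: pi_gt0. Qed.
Let t0 : 0 < t. Proof. by apply: lt_le_trans t_ge2. Qed.
Let l2 : (2 <= l)%N.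
Proof.
rewrite -(ler_nat R); apply: le_trans l_ge; apply: le_trans t_ge2 _.
by rewrite exprS ler_peMr ?(ltW t0)// exprn_ege1//; apply: le_trans t_ge2; rewrite ler1n.
Qed.
Let lnl0 : 0 <= ln l%:R :> R. Proof. by rewrite ln_ge0// ler1n; apply: ltn_trans l2. Qed.
Let n0 : (0 < n)%N. Proof. by apply: leq_trans l_le_n; apply: ltn_trans l2. Qed.
Let d0 : 0 < d.
Proof.
by rewrite -(pmulr_lgt0 _ t0); apply: lt_le_trans ln_l; rewrite ltr_pwDl.
Qed.

Let ln_le (k : nat) : (0 < k)%N -> ln k%:R <= k%:R - 1 :> R.
Proof.
move=> k0; have := @le_ln1Dx R (k%:R - 1).
by rewrite [1 + _]addrC subrK; apply; rewrite ltrBrDl subrr ltr0n.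
Qed.

Let lnM_nat (a b : nat) : (0 < a)%N -> (0 < b)%N ->
  ln (a * b)%N%:R = ln a%:R + ln b%:R :> R.
Proof. by move=> a0 b0; rewrite natrM lnM ?posrE ?ltr0n. Qed.

Let ler_ln_nat (a b : nat) : (0 < a)%N -> (a <= b)%N -> ln a%:R <= ln b%:R :> R.
Proof. by move=> a0 ab; rewrite ler_ln ?posrE ?ltr0n// ?ler_nat//; apply: leq_trans ab. Qed.

Let ln_N : t - ln l%:R <= ln N.+1%:R.
Proof.
rewrite lerBlDr -lnM_nat//; last by apply: ltn_trans l2.
by apply: ler_ln_nat => //; rewrite ltnW// ltn_ceil//; apply: ltn_trans l2.
Qed.

(** All the times between [N] and [l * n] have nearly the same logarithm. *)
Let lattice_green_range m : (N <= m)%N -> (m <= l * n)%N ->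
  t * (1 - d) <= pi * lattice_green R m /\ pi * lattice_green R m <= t * (1 + d).
Proof.
move=> Nm ml; split.
  apply: le_trans (lattice_green_ge R m).
  by have := ler_lnS R Nm; have := ln_N; move: ln_l; rewrite mulrC; lra.
apply: le_trans (lattice_green_le R m) _.
have h : ln m.+1%:R <= ln (2 * (l * n))%N%:R :> R.
  by apply: ler_ln_nat => //; have := l2; have := n0; clear -ml; nia.
rewrite !lnM_nat ?muln_gt0 ?n0 ?andbT// in h; try by apply: ltn_trans l2.
have := @ln_le 2 isT; move: ln_l h; rewrite -/t; lra.
Qed.

Let d_t : 9 <= d * t. Proof. by apply: le_trans ln_l; rewrite lerDl. Qed.

Let d1 : 0 < 1 - d. Proof. by move: d_le; lra. Qed.

Let c0_ge0 : 0 <= c0. Proof. exact: ler0n. Qed.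

Let hit_bound_ge0 : 0 <= c1 * d / (1 - d).
Proof. by rewrite divr_ge0 ?(ltW d1)// !mulr_ge0 ?(ltW pi0) ?(ltW d0)// addr_ge0// mulr_ge0. Qed.

Let hit_bound_le m : (N <= m)%N -> (m <= n + n)%N ->
  hit_bound c0 N m <= c1 * d / (1 - d).
Proof.
move=> Nm mn; have ml : (m <= l * n)%N.
  by apply: leq_trans mn _; rewrite addnn -mul2n leq_mul2r l2 orbT.
have [h1 _] := lattice_green_range Nm ml.
have h2 : ln (m + m).+1%:R <= ln (5 * n)%N%:R :> R.
  by apply: ler_ln_nat => //; have := n0; clear -mn; lia.
rewrite lnM_nat// in h2; have h5 := @ln_le 5 isT.
have h3 : ln (m + m).+1%:R - ln N.+1%:R <= d * t :> R.
  by have := ln_N; move: ln_l h2 h5; rewrite -/t; lra.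
rewrite ler_pdivrMr ?lattice_green_gt0//.
apply: (@le_trans _ _ ((1 + 2 * c0) * (d * t))).
  have : 2 * c0 * (ln (m + m).+1%:R - ln N.+1%:R) <= 2 * c0 * (d * t).
    by rewrite ler_wpM2l// mulr_ge0.
  by have := d_t; rewrite mulrDl mul1r; lra.
have -> : c1 * d / (1 - d) * lattice_green R m =
    (1 + 2 * c0) * d / (1 - d) * (pi * lattice_green R m).
  by rewrite /c1; ring.
apply: (@le_trans _ _ ((1 + 2 * c0) * d / (1 - d) * (t * (1 - d)))).
  rewrite le_eqVlt; apply/orP; left; apply/eqP.
  by field; rewrite gt_eqF.
rewrite ler_wpM2l// divr_ge0 ?(ltW d1)// mulr_ge0 ?(ltW d0)//.
by rewrite addr_ge0// mulr_ge0.
Qed.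

Let ln_range m : (m <= n)%N -> 1 + ln m.+1%:R <= t * (1 + d).
Proof.
move=> mn; have h : ln m.+1%:R <= ln (2 * n)%N%:R :> R.
  by apply: ler_ln_nat => //; have := n0; clear -mn; lia.
rewrite lnM_nat// in h; have h2 := @ln_le 2 isT.
by have := d_t; move: h h2; rewrite -/t; lra.
Qed.

Let killed_bound_ge m : (N <= m)%N -> (m <= n)%N ->
  t * gap d <= killed_green_bound c0 N m.
Proof.
move=> Nm mn; have mn2 : (m <= n + n)%N by clear -mn; lia.
have ml : (m <= l * n)%N.
  by apply: leq_trans mn _; rewrite -{1}[n]mul1n leq_mul2r (ltnW l2) orbT.
have [h1 _] := lattice_green_range Nm ml.
have -> : t * gap d = t * (1 - d) / pi - c1 * d / (1 - d) * (2 * (t * (1 + d))).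
  by rewrite /gap; ring.
rewrite /killed_green_bound lerB//; first by rewrite ler_pdivrMr// [leRHS]mulrC.
apply: (@le_trans _ _ (c1 * d / (1 - d) * (2 * (1 + ln m.+1%:R)))).
  by rewrite ler_wpM2r ?hit_bound_le// mulr_ge0// addr_ge0// lnS_ge0.
by rewrite ler_wpM2l// ler_wpM2l// ln_range.
Qed.

Let N_le_n : (N <= n)%N. Proof. exact: leq_div. Qed.

Let N_gt0 : (0 < N)%N. Proof. by rewrite divn_gt0//; apply: ltn_trans l2. Qed.

Let e : R := t^-1.

Let e0 : 0 < e. Proof. by rewrite invr_gt0. Qed.

Let l_gt0 : 0 < l%:R :> R. Proof. by rewrite ltr0n; apply: ltn_trans l2. Qed.

Let n_gt0 : 0 < n%:R :> R. Proof. by rewrite ltr0n. Qed.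

Let inv_l_le : l%:R^-1 <= e ^+ 4.
Proof. by rewrite exprVn lef_pV2 ?posrE ?exprn_gt0. Qed.

Let N_le : N%:R <= n%:R * e ^+ 4.
Proof.
apply: (@le_trans _ _ (n%:R / l%:R)); last by rewrite ler_wpM2l// ltW.
by rewrite ler_pdivlMr// -natrM ler_nat leq_trunc_div.
Qed.

Let e_le1 : e <= 1.
Proof. by rewrite invf_le1// (le_trans _ t_ge2)// ler1n. Qed.

Let visits_le x : green P n (ind R (bad_vertex R psi C C0 N)) x <=
  n%:R * (2 * K * (1 + d) ^+ 2 * e ^+ 2).
Proof.
apply: le_trans (green_bad N n x) _.
have h : (1 + ln n.+1%:R) ^+ 2 <= (t * (1 + d)) ^+ 2.
  by rewrite lerXn2r ?nnegrE ?ln_range// ?addr_ge0 ?lnS_ge0// mulr_ge0 ?(ltW t0)// addr_ge0// ltW.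
apply: (@le_trans _ _ (K * (2 * (n%:R * e ^+ 4)) * (t * (1 + d)) ^+ 2)).
  apply: ler_pM => //; [by rewrite mulr_ge0|exact: sqr_ge0|rewrite ler_wpM2l//].
  apply: (@le_trans _ _ (2 * N%:R)); last by rewrite ler_wpM2l.
  by rewrite -natrM ler_nat; have := N_gt0; clear; lia.
rewrite le_eqVlt; apply/orP; left; apply/eqP.
by rewrite /e; field; rewrite gt_eqF.
Qed.

Lemma mean_range_upper x : t / n%:R * mean_range P n x <= upper d e.
Proof.
have tg : 0 < t * gap d by rewrite mulr_gt0.
have kb := killed_bound_ge (leqnn N) N_le_n.
have := @mean_range_le _ _ _ hP (bad_vertex R psi C C0 N) N n (t * gap d)^-1 x.
rewrite invr_ge0 (ltW tg) => /(_ isT) h.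
apply: le_trans (_ : t / n%:R * (n%:R * e ^+ 4 + n%:R * (2 * K * (1 + d) ^+ 2 * e ^+ 2) +
    n.+1%:R * (t * gap d)^-1) <= _).
  rewrite ler_wpM2l ?divr_ge0 ?(ltW t0)//; apply: le_trans (h _) _.
    move=> y hy; rewrite -[leRHS]div1r ler_pdivlMr//.
    apply: le_trans (no_return_good_le hchart P1 hy); rewrite ler_wpM2l//.
    exact: no_return_ge0.
  by rewrite lerD2r lerD.
have -> : t / n%:R * (n%:R * e ^+ 4 + n%:R * (2 * K * (1 + d) ^+ 2 * e ^+ 2) +
    n.+1%:R * (t * gap d)^-1) = e ^+ 3 + 2 * K * (1 + d) ^+ 2 * e +
    (1 + n%:R^-1) / gap d.
  rewrite /e -natr1; field.
  by rewrite !gt_eqF.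
rewrite /upper; apply: lerD; first rewrite lerD2r.
  by rewrite exprS ler_piMr ?exprn_ile1 ?(ltW e0).
rewrite ler_wpM2r ?invr_ge0 ?(ltW gap_gt0)// lerD2l /e lef_pV2 ?posrE//.
by have := ln_le n0; rewrite -/t; lra.
Qed.

Lemma mean_range_lower x : 0 <= low d e ->
  lower d e <= t / n%:R * mean_range P n x.
Proof.
move=> low0.
have tg : 0 < t * gap d by rewrite mulr_gt0.
have kb := killed_bound_ge N_le_n (leqnn n).
have le_b y : ~~ bad_vertex R psi C C0 N y -> low d e / t <= no_return P n y.
  move=> hy; apply: le_trans (no_return_good_ge hchart hy l N_le_n (lt_le_trans tg kb)).
  have [_ h2] := @lattice_green_range (l * n) (leq_trans N_le_n (leq_pmull _ (ltnW l2))) (leqnn _).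
  rewrite /low mulrBl lerB//.
    apply: (@le_trans _ _ ((1 - 2 * e) / (t * (1 + d) / pi))).
      rewrite le_eqVlt; apply/orP; left; apply/eqP.
      move: (pi : R) pi0 => p p0.
      by field; rewrite !gt_eqF// addr_gt0.
    have e2 : 0 <= 1 - 2 * e.
      by rewrite subr_ge0 -ler_pdivlMr// invrK mul1r.
    have nl : n%:R / (l * n).+1%:R <= e.
      rewrite ler_pdivrMr ?ltr0n//.
      apply: (@le_trans _ _ (n%:R * (e * l%:R))).
        rewrite ler_peMr// /e mulrC ler_pdivlMr// mul1r.
        apply: le_trans l_ge; rewrite exprS ler_peMr ?(ltW t0)// exprn_ege1//.
        by apply: le_trans t_ge2; rewrite ler1n.
      by rewrite mulrCA ler_wpM2l ?(ltW e0)// -natrM ler_nat mulnC ltnW.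
    apply: ler_pM => //.
    - by rewrite invr_ge0 divr_ge0 ?(ltW pi0)// mulr_ge0 ?(ltW t0)// addr_ge0// ltW.
    - by rewrite lerB// -mulrA ler_wpM2l.
    - rewrite lef_pV2 ?posrE ?lattice_green_gt0//; last first.
        by rewrite divr_gt0// mulr_gt0// addr_gt0.
      by rewrite ler_pdivlMr// mulrC.
  apply: (@le_trans _ _ (c1 * d / (1 - d) / (t * gap d))).
    have hb0 : 0 <= hit_bound c0 N (n + n).
      apply: (@le_trans _ _ (hit (@lattice_step R) (mem C0) (n + n) (psi y))).
        exact: (hit_ge0 (sub_markov_lattice R)).
      by apply: (hit_good_le hy); rewrite addnA (leq_trans N_le_n) ?leq_addl.
    apply: ler_pM => //.
    - by rewrite invr_ge0 ltW// (lt_le_trans tg).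
    - by apply: hit_bound_le => //; rewrite (leq_trans N_le_n) ?leq_addl.
    - by rewrite lef_pV2 ?posrE// (lt_le_trans tg).
  rewrite le_eqVlt; apply/orP; left; apply/eqP.
  by field; rewrite !gt_eqF.
have b0 : 0 <= low d e / t by rewrite divr_ge0 ?(ltW t0).
have := mean_range_ge hP P1 x b0 le_b.
rewrite -(ler_pM2l (divr_gt0 t0 n_gt0)); apply: le_trans.
have -> : lower d e = t / n%:R * (low d e / t *
    (n%:R - n%:R * (2 * K * (1 + d) ^+ 2 * e))).
  by rewrite /lower; field; rewrite !gt_eqF.
rewrite ler_wpM2l ?divr_ge0 ?(ltW t0)// ler_wpM2l// lerB ?ler_nat//.
apply: le_trans (visits_le x) _; rewrite ler_wpM2l ?(ltW n_gt0)//.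
rewrite ler_wpM2l//; first by rewrite mulr_ge0 ?sqr_ge0// mulr_ge0.
by rewrite expr2 ler_piMr// ltW.
Qed.

End Sandwich.

Section Limit.
Variables (R : realType) (G : sgraph).

(** The choice of parameters: [l] is a fourth power of about [ln n], and [d] is
    the smallest value allowed by the bounds above. *)
Let t n : R := ln n%:R.
Let l n := ((Num.truncn (t n)).+1 ^ 4)%N.
Let e n : R := (t n)^-1.
Let d n : R := (9 + ln (l n)%:R) / t n.

Lemma near_ln_ge (a : R) : \forall n \near \oo, a <= ln n%:R.
Proof.
near=> n; rewrite -[leLHS]expRK ler_ln ?posrE ?expR_gt0//.
  by near: n; exact: nbhs_infty_ger.
by rewrite ltr0n; near: n; exact: nbhs_infty_gt.
Unshelve. all: by end_near. Qed.

Lemma cvg_inv_ln : e @ \oo --> 0.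
Proof.
apply/cvgrPdist_le => eps eps0; near=> n.
have tn : eps^-1 <= t n by near: n; exact: near_ln_ge.
have tn0 : 0 < t n by apply: lt_le_trans tn; rewrite invr_gt0.
rewrite sub0r normrN ger0_norm ?invr_ge0 ?(ltW tn0)//.
by rewrite /e -[leRHS]invrK lef_pV2 ?posrE ?invr_gt0.
Unshelve. all: by end_near. Qed.

Lemma ln1D_le_sqrt (x : R) : 0 <= x -> ln (1 + x) <= 2 * Num.sqrt x.
Proof.
move=> x0; have s0 : 0 <= Num.sqrt x by exact: sqrtr_ge0.
apply: (@le_trans _ _ (ln ((1 + Num.sqrt x) ^+ 2))).
  rewrite ler_ln ?posrE ?exprn_gt0 ?ltr_pwDl//.
  by rewrite sqrrD expr1n mul1r sqr_sqrtr// lerD2r lerDl mulrn_wge0.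
rewrite lnXn ?ltr_pwDl// -[leLHS]mulr_natl ler_wpM2l//.
by apply: le_ln1Dx; rewrite (lt_le_trans _ s0)// ltrN10.
Qed.

(** The logarithm of [l] is negligible with respect to [ln n]. *)
Lemma cvg_ln_log : d @ \oo --> 0.
Proof.
have ub : (fun n => 9 * e n + 8 * Num.sqrt (e n)) @ \oo --> (0 : R).
  rewrite [X in _ --> X](_ : 0 = 9 * 0 + 8 * Num.sqrt 0); last by rewrite sqrtr0 !mulr0 addr0.
  apply: cvgD; apply: cvgM; try exact: cvg_cst; first exact: cvg_inv_ln.
  by apply: (continuous_cvg _ _ cvg_inv_ln); exact: sqrt_continuous.
apply: (squeeze_cvgr _ (cvg_cst 0) ub); near=> n.
have tn : 1 <= t n by near: n; exact: near_ln_ge.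
have tn0 : 0 < t n by apply: lt_le_trans tn.
have l0 : 1 <= (l n)%:R :> R by rewrite ler1n expn_gt0.
apply/andP; split; first by rewrite divr_ge0 ?(ltW tn0)// addr_ge0// ln_ge0.
rewrite /d mulrDl lerD2l ler_pdivrMr//.
have -> : 8 * Num.sqrt (e n) * t n = 8 * Num.sqrt (t n).
  rewrite /e sqrtrV ?(ltW tn0)// -{2}[t n]sqr_sqrtr ?(ltW tn0)// expr2.
  by field; rewrite gt_eqF// sqrtr_gt0.
rewrite /l natrX lnXn ?ltr0n// -[leLHS]mulr_natl.
have : ln (Num.truncn (t n)).+1%:R <= 2 * Num.sqrt (t n).
  apply: le_trans (ln1D_le_sqrt (ltW tn0)).
  rewrite ler_ln ?posrE ?ltr0n ?addr_gt0// -natr1 addrC lerD2l.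
  by have /andP[] := truncn_itv (ltW tn0).
lra.
Unshelve. all: by end_near. Qed.

Variables (psi : G -> int * int) (B C : seq G) (C0 : seq (int * int)).
Hypothesis hchart : chart psi B C C0.

Let P := @graph_step R G.

Hypothesis P1 : P (fun=> 1) = fun=> 1.
Hypothesis Gconn : connected_graph G.
Hypothesis Gdeg : bounded_degrees G.

Lemma cvg_gap : gap C0 (d n) @[n --> \oo] --> (pi^-1 : R).
Proof.
rewrite /gap [X in _ --> X](_ : _ = (1 - 0) / pi -
  pi * (1 + 2 * (size C0)%:R) * 0 / (1 - 0) * (2 * (1 + 0))); last first.
  by rewrite !subr0 !mulr0 !mul0r subr0 mul1r.
have cd := cvg_ln_log.
have cB : (fun n => 1 - d n) @ \oo --> (1 - 0 : R) by apply: cvgB => //; exact: cvg_cst.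
have cD : (fun n => 1 + d n) @ \oo --> (1 + 0 : R) by apply: cvgD => //; exact: cvg_cst.
apply: cvgB; first by apply: cvgM => //; exact: cvg_cst.
apply: cvgM; last by apply: cvgM => //; exact: cvg_cst.
apply: cvgM; first by apply: cvgM => //; exact: cvg_cst.
by apply: cvgV => //; rewrite subr0 oner_eq0.
Qed.

Lemma mean_range_cvg (x : G) :
  ln n%:R / n%:R * mean_range P n x @[n --> \oo] --> (pi : R).
Proof.
have [K K0 hK] := green_bad_le hchart P1 Gconn Gdeg.
have pi0 : (pi : R) != 0 by rewrite gt_eqF// pi_gt0.
have ce := cvg_inv_ln; have cd := cvg_ln_log; have cg := cvg_gap.
have cgV : (fun n => (gap C0 (d n))^-1) @ \oo --> (pi : R).
  by rewrite -[X in _ --> X]invrK; apply: cvgV => //; rewrite invr_eq0.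
have cB : (fun n => 1 - d n) @ \oo --> (1 - 0 : R) by apply: cvgB => //; exact: cvg_cst.
have cD : (fun n => 1 + d n) @ \oo --> (1 + 0 : R) by apply: cvgD => //; exact: cvg_cst.
have cK : (fun n => 2 * K * (1 + d n) ^+ 2 * e n) @ \oo -->
    (2 * K * ((1 + 0) * (1 + 0)) * 0 : R).
  apply: cvgM => //; apply: cvgM; first exact: cvg_cst.
  by under eq_fun do rewrite expr2; exact: cvgM.
have clow : low C0 (d n) (e n) @[n --> \oo] --> (pi : R).
  rewrite /low [X in _ --> X](_ : _ = (1 - 2 * 0) * pi / (1 + 0) -
    pi * (1 + 2 * (size C0)%:R) * 0 / (1 - 0) * pi); last first.
    by rewrite !mulr0 !mul0r !subr0 addr0 mul1r divr1.
  apply: cvgB.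
    apply: cvgM; last by apply: cvgV => //; rewrite addr0 oner_eq0.
    apply: cvgM; last exact: cvg_cst.
    by apply: cvgB; [exact: cvg_cst|apply: cvgM => //; exact: cvg_cst].
  apply: cvgM => //; apply: cvgM; first by apply: cvgM => //; exact: cvg_cst.
  by apply: cvgV => //; rewrite subr0 oner_eq0.
have cup : upper C0 K (d n) (e n) @[n --> \oo] --> (pi : R).
  rewrite /upper [X in _ --> X](_ : _ = 0 + 2 * K * ((1 + 0) * (1 + 0)) * 0 + (1 + 0) * pi).
    apply: cvgD; first exact: cvgD.
    by apply: cvgM => //; apply: cvgD => //; exact: cvg_cst.
  by rewrite !mulr0 !addr0 add0r mul1r.
have clo : lower C0 K (d n) (e n) @[n --> \oo] --> (pi : R).
  rewrite /lower [X in _ --> X](_ : _ = pi * (1 - 2 * K * ((1 + 0) * (1 + 0)) * 0)).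
    by apply: cvgM => //; apply: cvgB => //; exact: cvg_cst.
  by rewrite !mulr0 subr0 mulr1.
have near_pos (f : nat -> R) (a : R) : 0 < a -> f n @[n --> \oo] --> a ->
    \forall n \near \oo, 0 < f n.
  by move=> a0 /cvgr_gt; apply.
apply: (squeeze_cvgr _ clo cup); near=> n.
have tn : 2 <= t n by near: n; exact: near_ln_ge.
have tn0 : 0 < t n by apply: lt_le_trans tn.
have dn : d n <= 2^-1 by near: n; apply: (cvgr_le 0) => //; rewrite invr_gt0.
have gn : 0 < gap C0 (d n).
  by near: n; apply: near_pos cg; rewrite invr_gt0 pi_gt0.
have lown : 0 <= low C0 (d n) (e n).
  by apply/ltW; near: n; apply: near_pos clow; exact: pi_gt0.
have ln_l : 9 + ln (l n)%:R <= d n * t n by rewrite divfK// gt_eqF.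
have l0 : (0 < l n)%N by rewrite expn_gt0.
have n0 : (0 < n)%N by near: n; exact: nbhs_infty_gt.
have l_ge : t n ^+ 4 <= (l n)%:R.
  rewrite /l natrX lerXn2r ?nnegrE ?(ltW tn0)//.
  by apply: ltW; exact: truncnS_gt.
have l_le : (l n <= n)%N.
  rewrite -(ler_nat R) -ler_ln ?posrE ?ltr0n// -/(t n).
  have : d n * t n <= 2^-1 * t n by rewrite ler_wpM2r// ltW.
  lra.
apply/andP; split.
  by apply: (mean_range_lower hchart P1 (ltW K0) hK l_le tn l_ge dn ln_l gn).
exact: (mean_range_upper hchart P1 (ltW K0) hK l_le tn l_ge dn ln_l gn).
Unshelve. all: by end_near. Qed.

End Limit.

(** * Trajectories *)

Section Paths.
Variables (R : realType) (G : sgraph).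
Hypothesis Gdeg : bounded_degrees G.
Implicit Types (x y : G) (p : seq G) (F : seq G -> R).

Let P := @graph_step R G.

(** The paths of length [n] from [x], without their initial vertex; the
    probability that the walk from [x] follows a given path; and the mean of a
    function of the path. *)
Fixpoint walk_paths n x : seq (seq G) :=
  if n is m.+1 then [seq y :: p | y <- fset_set (neighbours x), p <- walk_paths m y]
  else [:: [::]].

Fixpoint path_weight x p : R :=
  if p is y :: p' then srw_trans R x y * path_weight y p' else 1.

Definition path_mean n x F : R := \sum_(p <- walk_paths n x) path_weight x p * F p.

Lemma path_meanS n x F :
  path_mean n.+1 x F = P (fun y => path_mean n y (fun p => F (y :: p))) x.
Proof.
rewrite /path_mean /= big_allpairs_dep.
rewrite /P /graph_step mulr_sumr big_seq [RHS]big_seq; apply: eq_bigr => y.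
rewrite mem_neighbours// => xy; rewrite mulr_sumr; apply: eq_bigr => p _ /=.
by rewrite /srw_trans xy mulrA.
Qed.

Lemma path_mean_avoid (A : pred G) n x :
  path_mean n x (fun p => (all (predC A) p)%:R) = avoid P A n x.
Proof.
elim: n x => [|n IH] x; first by rewrite /path_mean big_seq1 mul1r.
rewrite path_meanS; congr (P _ x); apply/funext => y.
rewrite -[RHS]/((~~ A y)%:R * avoid P A n y) -IH /path_mean mulr_sumr; apply: eq_bigr => p _ /=.
by case: (A y); rewrite ?mul0r ?mulr0 ?mul1r.
Qed.

Lemma path_mean_weight n x : P (fun=> 1) = (fun=> 1) ->
  \sum_(p <- walk_paths n x) path_weight x p = 1.
Proof.
move=> P1; transitivity (path_mean n x (fun=> 1)).
  by apply: eq_bigr => p _; rewrite mulr1.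
elim: n x => [|n IH] x; first by rewrite /path_mean big_seq1 mul1r.
by rewrite path_meanS (_ : (fun y => _) = fun=> 1) ?P1//; exact/funext.
Qed.

(** The function [undup] keeps the last occurrence of each vertex. *)
Lemma path_mean_range n x :
  path_mean n x (fun p => (size (undup (x :: p)))%:R) = mean_range P n x.
Proof.
elim: n x => [|n IH] x.
  by rewrite /path_mean big_seq1 mul1r /mean_range big_ord1.
rewrite /mean_range big_ord_recl subn0.
transitivity (no_return P n.+1 x + path_mean n.+1 x (fun p => (size (undup p))%:R)).
  rewrite /no_return -path_mean_avoid /path_mean -big_split.
  apply: eq_bigr => p _; rewrite -[RHS]mulrDr; congr (_ * _).
  have -> : all (predC (pred1 x)) p = (x \notin p) by rewrite all_predC has_pred1.
  by rewrite /=; case: (x \in p); rewrite ?add0r //= -natr1 addrC.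
congr (_ + _); rewrite path_meanS.
transitivity (P (mean_range P n) x).
  by congr (P _ x); apply/funext => y; rewrite -IH.
exact: (congr1 (fun f => f x) (sm_sum (sub_markov_graph R G) _
  (fun k : 'I_n.+1 => iter k P (no_return P (n - k))))).
Qed.

Lemma size_walk_paths n x p : p \in walk_paths n x -> size p = n.
Proof.
elim: n x p => [|n IH] x p /=; first by rewrite inE => /eqP ->.
by case/allpairsPdep => y [p' [_ /IH h ->]]; rewrite /= h.
Qed.

Lemma walk_paths_uniq n x : uniq (walk_paths n x).
Proof.
elim: n x => //= n IH x; apply: allpairs_uniq_dep; rewrite ?fset_uniq//.
by move=> [y p] [z q] _ _ /= [-> ->].
Qed.

Lemma mem_walk_paths x p : path (@adj G) x p -> p \in walk_paths (size p) x.
Proof.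
elim: p x => //= y p IH x /andP[xy /IH h].
by apply/allpairsPdep; exists y, p; rewrite mem_neighbours.
Qed.

Lemma connected_countable (o : G) : connected_graph G -> countable [set: G].
Proof.
move=> Gconn.
have -> : [set: G] = \bigcup_(n in [set: nat]) [set` [seq last o p | p <- walk_paths n o]].
  apply/seteqP; split => // y _; have [p op <-] := Gconn o y.
  exists (size p) => //=; apply: map_f; exact: mem_walk_paths.
apply: bigcup_countable => // n _; exact/finite_set_countable/finite_seq.
Qed.

Lemma path_weight_prod x p : path_weight x p =
  \prod_(i < size p) srw_trans R (nth x (x :: p) i) (nth x (x :: p) i.+1).
Proof.
elim: p x => [|y p IH] x; first by rewrite big_ord0.
rewrite big_ord_recl /= IH; congr (_ * _); apply: eq_bigr => -[i hi] _ /=.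
rewrite (set_nth_default x y hi); congr (srw_trans R _ _).
by apply: set_nth_default; rewrite /= ltnW.
Qed.

End Paths.

Section Bridge.
Variables (R : realType) (G : sgraph) (o : G).
Variables (d : measure_display) (T : measurableType d) (Pr : probability T R).
Variables (S : nat -> T -> G) (hS : simple_random_walk o Pr S).
Hypothesis Gdeg : bounded_degrees G.
Hypothesis Gconn : connected_graph G.

Let P := @graph_step R G.
Hypothesis P1 : P (fun=> 1) = fun=> 1.

Lemma walk_prefix_prob n (x : nat -> G) :
  Pr [set w | forall i, (i <= n)%N -> S i w = x i] =
  ((x 0%N == o)%:R * \prod_(i < n) srw_trans R (x i) (x i.+1))%:E.
Proof.
elim: n => [|n IH]; last first.
  by rewrite (srw_step hS) IH -EFinM -mulrA big_ord_recr.
rewrite big_ord0 mulr1.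
have -> : [set w | forall i, (i <= 0)%N -> S i w = x i] = S 0%N @^-1` [set x 0%N].
  apply/seteqP; split => w /= h; first exact: h.
  by move=> i; rewrite leqn0 => /eqP ->.
have [->|xo] := eqVneq (x 0%N) o; first exact: (srw_start hS).
have m0 : measurable (S 0%N @^-1` [set o]) by exact: (srw_measurable hS).
have := probability_setC Pr m0; rewrite (srw_start hS) subee// => h.
rewrite -[RHS]/(0%E); apply/eqP; rewrite eq_le measure_ge0 andbT -[leRHS]h.
apply: le_measure; rewrite ?inE.
- exact: (srw_measurable hS).
- exact: measurableC.
- by move=> w /= -> /eqP; rewrite (negbTE xo).
Qed.

(** The vertices visited up to time [n]. *)
Definition trajectory n (w : T) : seq G := [seq S i w | i <- iota 0 n.+1].

(** The event that the first [n + 1] vertices visited are those of [p]. *)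
Definition follows n (p : seq G) : set T :=
  [set w | forall i, (i <= n)%N -> S i w = nth o p i].

Lemma measurable_follows n p : measurable (follows n p).
Proof.
have -> : follows n p = \bigcap_(i in [set i | (i <= n)%N]) (S i @^-1` [set nth o p i]) by [].
by apply: bigcap_measurable; [exists 0%N|move=> k _; exact: (srw_measurable hS)].
Qed.

Lemma followsP n p w : size p = n.+1 -> follows n p w <-> trajectory n w = p.
Proof.
move=> sp; split=> [h|<- i ni].
  apply: (@eq_from_nth _ o); rewrite size_map size_iota// => i ni.
  by rewrite (nth_map 0%N) ?size_iota// nth_iota// add0n h.
by rewrite (nth_map 0%N) ?size_iota ?ltnS// nth_iota// ltnS.
Qed.

Lemma follows_prob n p : size p = n ->
  Pr (follows n (o :: p)) = (path_weight R o p)%:E.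
Proof.
move=> sp; rewrite /follows (walk_prefix_prob n (fun i => nth o (o :: p) i)).
by rewrite /= eqxx mul1r path_weight_prod sp.
Qed.

Lemma range_size_trajectory n w : range_size S n w = size (undup (trajectory n w)).
Proof.
rewrite /range_size -(size_seq_fset tt); congr (size (enum_fset _)).
rewrite -[RHS]set_fsetK; congr fset_set.
have memA y : (y \in seq_fset tt (trajectory n w)) = (y \in trajectory n w).
  exact: seq_fsetE.
apply/seteqP; split => y.
  move=> [i ni <-]; suff : S i w \in trajectory n w by rewrite -memA.
  by apply: map_f; rewrite mem_iota.
move=> yA; have : y \in trajectory n w by rewrite -memA.
by case/mapP => i; rewrite mem_iota add0n => ni ->; exists i.
Qed.

(** As [G] is countable, so is the set of its finite sequences. *)
Lemma measurable_trajectory n (F : seq G -> R) :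
  measurable_fun setT (fun w => F (trajectory n w)).
Proof.
have /countable_injP[f finj] := connected_countable Gdeg o Gconn.
have cseq : countable [set: seq G].
  have : countable [set: seq nat] by exact: countableP.
  case/countable_injP => g ginj; apply/countable_injP; exists (g \o map f).
  move=> p q _ _ /= /(ginj _ _ (mem_setT _) (mem_setT _)).
  by apply: inj_map => a b; apply: finj; rewrite in_setT.
move=> _ Y mY; rewrite setTI.
have -> : (fun w => F (trajectory n w)) @^-1` Y =
    \bigcup_p (if `[< Y (F p) /\ size p = n.+1 >] then follows n p else set0).
  apply/seteqP; split => w /=.
    move=> Yw; exists (trajectory n w) => //.
    rewrite ifT; last by apply/asboolP; rewrite size_map size_iota.
    by apply/followsP; rewrite ?size_map ?size_iota.
  by move=> [p _]; case: asboolP => // -[Yp sp] /(followsP _ sp) ->.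
apply: countable_bigcupT_measurable => // p.
by case: ifP => _; [exact: measurable_follows|exact: measurable0].
Qed.

Lemma follows_triv n : trivIset [set` walk_paths n o] (fun p => follows n (o :: p)).
Proof.
move=> p q /= hp hq [w [wp wq]].
have sp := size_walk_paths hp; have sq := size_walk_paths hq.
have /followsP := wp; rewrite /= sp => /(_ erefl) e.
have /followsP := wq; rewrite /= sq => /(_ erefl); rewrite e => -[].
by [].
Qed.

(** Almost surely the trajectory is one of the finitely many paths from [o]. *)
Lemma expectation_trajectory n (F : seq G -> R) : (forall p, 0 <= F p) ->
  ('E_Pr[fun w => F (trajectory n w)] = (path_mean n o (fun p => F (o :: p)))%:E)%E.
Proof.
move=> F0; rewrite unlock.
set U := \big[setU/set0]_(p <- walk_paths n o) follows n (o :: p).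
have mU : measurable U by apply: bigsetU_measurable => p _; exact: measurable_follows.
have mF D : measurable_fun D (EFin \o (fun w => F (trajectory n w))).
  by apply: measurable_funTS; apply/measurable_EFinP; exact: measurable_trajectory.
have intU (f : T -> \bar R) : measurable_fun U f -> (forall w, 0 <= f w)%E ->
    (\int[Pr]_(w in U) f w = \sum_(p <- walk_paths n o) \int[Pr]_(w in follows n (o :: p)) f w)%E.
  move=> mf f0; apply: ge0_integral_bigsetU => //.
  - by move=> p; exact: measurable_follows.
  - exact: walk_paths_uniq.
  - exact: follows_triv.
have U1 : Pr U = 1%E.
  have := intU (cst 1%E) (measurable_cst _) (fun=> lee01).
  rewrite integral_cst// mul1e => ->.
  transitivity (\sum_(p <- walk_paths n o) path_weight R o p)%:E; last first.
    by rewrite path_mean_weight.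
  rewrite -sumEFin big_seq [RHS]big_seq.
  apply: eq_bigr => p /size_walk_paths sp.
  rewrite integral_cst ?mul1e//; first exact: follows_prob.
  exact: measurable_follows.
have UC0 : Pr (~` U) = 0%E by rewrite probability_setC// U1 subee.
rewrite (ge0_negligible_integral (N := ~` U)) ?setTD ?setCK//; last 2 first.
- exact: measurableC.
- by move=> w _; rewrite lee_fin.
rewrite intU//; last by move=> w; rewrite lee_fin.
rewrite /path_mean -sumEFin big_seq [RHS]big_seq; apply: eq_bigr => p pn.
have sp := size_walk_paths pn.
rewrite (eq_integral (cst (F (o :: p))%:E)); last first.
  move=> w; rewrite inE => /followsP /= h; rewrite h//= sp//.
rewrite integral_cst; last exact: measurable_follows.
rewrite -[X in (_ * X)%E]/(Pr (follows n (o :: p))) follows_prob//.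
by rewrite -EFinM mulrC.
Qed.

Lemma expectation_range n :
  ('E_Pr[fun w => (range_size S n w)%:R : R] = (mean_range P n o)%:E)%E.
Proof.
rewrite -path_mean_range// -(expectation_trajectory n (fun p => ler0n R (size (undup p)))).
by congr ('E_Pr[_])%E; apply/funext => w; rewrite range_size_trajectory.
Qed.

End Bridge.

Theorem theorem1p7 (R : realType) (G : sgraph)
    (Ginf : infinite_set [set: G])
    (Gconn : connected_graph G)
    (Gdeg : bounded_degrees G)
    (Gmod : finite_modification Z2 G)
    (o : G)
    (d : measure_display) (T : measurableType d) (P : probability T R)
    (S : nat -> T -> G) (hS : simple_random_walk o P S) :
  ((ln n%:R / n%:R : R)%:E * 'E_P[fun w : T => (range_size S n w)%:R : R])%E
    @[n --> \oo] --> (pi : R)%:E.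
Proof.
have P1 := graph_step1 R Gdeg (connected_has_neighbour Ginf Gconn).
have [psi [B [C [C0 hchart]]]] := chart_exists o Gdeg Gmod.
have -> : (fun n => ((ln n%:R / n%:R : R)%:E *
      'E_P[fun w : T => (range_size S n w)%:R : R])%E) =
    EFin \o (fun n => ln n%:R / n%:R * mean_range (@graph_step R G) n o).
  by apply/funext => n; rewrite (expectation_range hS Gdeg Gconn P1) -EFinM.
by apply: cvg_EFin; [exact: nearW|exact: (mean_range_cvg hchart P1 Gconn Gdeg)].
Qed.
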